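(* Let $n\in\mathbb N$. For $0\le t\le n-1$ set $$\mathcal C^{(B)}_{n,t}:=\sum_{k=0}^{n-1}\left\langle {2n-1 \atop k}\right\rangle^{B}(-1)^{k}\sum_{i=0}^{k}(-1)^i\binom{k}{i}\binom{2n-2k-1}{2t-2i+1},$$ $$\mathcal C^{(A)}_{n,t}:=\sum_{k=0}^{n-1}\left\langle {2n \atop k}\right\rangle(-1)^{k}\sum_{i=0}^{k}(-1)^i\binom{k}{i}\binom{2n-2k-1}{2t-2i+1},$$ and consider the even polynomials $\Xi_n,\Lambda_n\in\mathbb Q[x]$ of degree at most $2n-2$ given by $$\Xi_n(x)=\frac{(-1)^{n+1}}{2^{4n-2}(2n-1)!}\sum_{t=0}^{n-1}\mathcal C^{(B)}_{n,t}\,x^{2t},\qquad \Lambda_n(x)=\frac{2(-1)^{n+1}}{(2^{2n+1}-1)(2n)!}\sum_{t=0}^{n-1}\mathcal C^{(A)}_{n,t}\,x^{2t}.$$ Then $$\frac{\beta(2n)}{\pi^{2n-1}}=\int_0^1 \frac{x\,\Xi_n(x)}{\sqrt{1-x^2}\,\operatorname{arctanh}x}\,dx,\qquad \frac{\zeta(2n+1)}{\pi^{2n}}=\int_0^1 \frac{x\,\Lambda_n(x)}{\operatorname{arctanh}x}\,dx.$$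
   Context: $\mathbb N=\{1,2,3,\dots\}$. $\zeta$ is the Riemann zeta function and $\beta(s)=\sum_{m\ge0}(-1)^m(2m+1)^{-s}$ is the Dirichlet beta function. Binomial coefficients satisfy $\binom{m}{\ell}=0$ whenever $\ell<0$ or $\ell>m$. The Eulerian number of type $A$, $\left\langle{m\atop k}\right\rangle$ ($m\ge1$, $0\le k\le m-1$), is the number of permutations of $\{1,\dots,m\}$ with exactly $k$ descents; equivalently $\sum_{j\ge0}(j+1)^m x^j=(1-x)^{-m-1}\sum_{k=0}^{m-1}\left\langle{m\atop k}\right\rangle x^k$ for $|x|<1$. The Eulerian number of type $B$, $\left\langle{m\atop k}\right\rangle^{B}$ ($m\ge0$, $0\le k\le m$), is determined by $\sum_{j\ge0}(2j+1)^m x^j=(1-x)^{-m-1}\sum_{k=0}^{m}\left\langle{m\atop k}\right\rangle^{B} x^k$ for $|x|<1$. *)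

(* Defs.v *)
From HB Require Import structures.
From mathcomp Require Import all_boot all_order all_algebra perm.
From mathcomp Require Import all_classical all_reals all_analysis.
From mathcomp Require Import ring.

Set Implicit Arguments.
Unset Strict Implicit.
Unset Printing Implicit Defensive.

Import Order.TTheory GRing.Theory Num.Theory.
Import numFieldNormedType.Exports.

Local Open Scope classical_set_scope.
Local Open Scope ring_scope.

(** A descent of [s] is recorded as the pair [(i, i+1)] of consecutive
    positions at which it occurs. *)
Definition descents (m : nat) (s : 'S_m) : {set 'I_m * 'I_m} :=
  [set p : 'I_m * 'I_m | (p.2 == p.1.+1 :> nat) && (s p.2 < s p.1)%N].

Definition eulerianA (m k : nat) : nat :=
  #|[set s : 'S_m | #|descents s| == k]|.

(** Coefficient of [x^k] in [(1-x)^(m+1) * \sum_(j >= 0) (2j+1)^m x^j]; the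
    terms of the series with [j > k] do not contribute to it.  The analytic
    form of the generating-function identity, with a numerator of degree at
    most [m], is [eulerianB_gf] below, and [eulerianB_unique] states that this
    identity determines the numbers. *)
Definition eulerianB (m k : nat) : int :=
  ((1 - 'X) ^+ m.+1 * \poly_(j < k.+1) ((2 * j + 1) ^ m)%N%:Z)`_k.

(** Binomial coefficient whose lower index may be negative, in which case it
    vanishes: truncated subtraction on [nat] would be wrong here. *)
Definition binz (m : nat) (l : int) : nat :=
  if l is Posz j then 'C(m, j) else 0%N.

Definition calC_B (n t : nat) : int :=
  \sum_(0 <= k < n) eulerianB (2 * n - 1) k * (-1) ^+ k *
    \sum_(0 <= i < k.+1) (-1) ^+ i * 'C(k, i)%:Z *
      (binz (2 * n - 2 * k - 1) ((2 * t)%N%:Z - (2 * i)%N%:Z + 1))%:Z.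

Definition calC_A (n t : nat) : int :=
  \sum_(0 <= k < n) (eulerianA (2 * n) k)%:Z * (-1) ^+ k *
    \sum_(0 <= i < k.+1) (-1) ^+ i * 'C(k, i)%:Z *
      (binz (2 * n - 2 * k - 1) ((2 * t)%N%:Z - (2 * i)%N%:Z + 1))%:Z.

Definition Xi (n : nat) : {poly rat} :=
  ((-1) ^+ n.+1 / (2 ^+ (4 * n - 2) * ((2 * n - 1)`!)%:R)) *:
    \sum_(0 <= t < n) (calC_B n t)%:~R *: 'X^(2 * t).

Definition Lambda (n : nat) : {poly rat} :=
  (2 * (-1) ^+ n.+1 / ((2 ^+ (2 * n + 1) - 1) * ((2 * n)`!)%:R)) *:
    \sum_(0 <= t < n) (calC_A n t)%:~R *: 'X^(2 * t).

Section Real.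
Variable R : realType.

Definition eval_rat (p : {poly rat}) (x : R) : R := (map_poly ratr p).[x].

(** For [1 < s] this is the value of the Riemann zeta function. *)
Definition zeta (s : R) : R := limn (series (riemannR s)).

(** For [0 < s] this is the value of the Dirichlet beta function. *)
Definition dirichlet_beta (s : R) : R :=
  limn (series (fun m : nat => (-1) ^+ m * (2 * m + 1)%:R `^ (- s))).

Definition artanh (x : R) : R := ln ((1 + x) / (1 - x)) / 2.

End Real.

Section EulerianB.

Let S (m N : nat) : {poly int} := \poly_(j < N) ((2 * j + 1) ^ m)%N%:Z.

Let step (m : nat) (p : {poly int}) : {poly int} :=
  2 * 'X * (1 - 'X) * p^`() + (2 * m.+1%:R * 'X + (1 - 'X)) * p.

Let numer := fix numer m : {poly int} :=
  if m is m'.+1 then step m' (numer m') else 1.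

Let S_rec m N : S m.+1 N = 2 * 'X * (S m N)^`() + S m N.
Proof.
rewrite -mulrA mulr_natl; apply/polyP=> i.
rewrite coefD coefMn coefXM coef_deriv !coef_poly.
case: i => [|i] /=; first by rewrite mul0rn add0r muln0 add0n !exp1n.
case: ifP => _; last by rewrite mul0rn mul0rn add0r.
by rewrite expnS mulnDl mul1n PoszD PoszM -mulrnA -mulr_natl natz (mulnC _ 2%N).
Qed.

Let trunc_numer m : exists r : {poly {poly int}}, forall N,
  (1 - 'X) ^+ m.+1 * S m N = numer m + 'X^N * r.[N%:R].
Proof.
elim: m => [|m [r IH]].
  exists (-1) => N; rewrite hornerN hornerC mulrN1 expr1 -opprB mulNr.
  rewrite -[RHS]opprB; congr (- _); rewrite /= subrX1; congr (_ * _).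
  rewrite /S poly_def; apply: eq_bigr => i _.
  by rewrite expn0 scale1r.
pose a : {poly int} := 2 * 'X * (1 - 'X).
pose b : {poly int} := 2 * m.+1%:R * 'X + (1 - 'X).
pose c : {poly int} := 2 * (1 - 'X).
exists (a%:P * map_poly (fun p => p^`()) r + c%:P * 'X * r + b%:P * r) => N.
have evD : (map_poly (fun p : {poly int} => p^`()) r).[N%:R] = (r.[N%:R])^`().
  rewrite (horner_coef_wide _ (size_poly _ _)) horner_coef raddf_sum /=.
  apply: eq_bigr => i _; rewrite coef_map_id0 ?derivC// derivM.
  by rewrite -natrX -polyC_natr derivC mulr0 addr0.
have mulE : (1 - 'X) ^+ m.+2 * (2 * 'X * (S m N)^`() + S m N) =
   step m ((1 - 'X) ^+ m.+1 * S m N).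
  rewrite /step derivM deriv_exp derivB derivX derivC sub0r /= -mulr_natr.
  by rewrite !exprS; ring.
have XN : 'X * ('X^N)^`() = N%:R * 'X^N :> {poly int}.
  rewrite derivXn; case: N {evD mulE} => [|N]; first by rewrite mulr0n mul0r mulr0.
  by rewrite /= -mulr_natl mulrCA -exprS.
rewrite S_rec mulE IH /step /= /step derivD derivM.
rewrite !(hornerD, hornerM, hornerC, hornerX) evD /a /b /c.
transitivity (2 * 'X * (1 - 'X) * (numer m)^`()
  + (2 * m.+1%:R * 'X + (1 - 'X)) * numer m
  + (2 * (1 - 'X) * r.[N%:R] * ('X * ('X^N)^`())
     + 2 * 'X * (1 - 'X) * 'X^N * r.[N%:R]^`()
     + (2 * m.+1%:R * 'X + (1 - 'X)) * 'X^N * r.[N%:R])); first by ring.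
by rewrite XN; ring.
Qed.

Let size_numer m : (size (numer m) <= m.+1)%N.
Proof.
elim: m => [|m IH]; first by rewrite size_poly1.
rewrite /= /step; move: (numer m) IH => p IH; apply/leq_sizeP => j lej.
have c0 i : (m < i)%N -> p`_i = 0 by move=> h; rewrite nth_default// (leq_trans IH).
have -> : 2 * 'X * (1 - 'X) * p^`() + (2 * m.+1%:R * 'X + (1 - 'X)) * p =
  ('X * (p^`() + p *+ m.+1)) *+ 2 - ('X * ('X * p^`())) *+ 2 + p - 'X * p.
  by ring.
have [i jE] : exists i, j = i.+2 by exists j.-2; move: lej; case: j => [|[]].
rewrite {}jE in lej *.
rewrite !(coefD, coefN, coefMn, coefXM) /= !coef_deriv.
have h1 : (m < i.+1)%N by [].
have h2 : (m < i.+2)%N by exact: ltnW.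
by rewrite (c0 _ h1) (c0 _ h2) !(mul0rn, addr0, subr0, oppr0).
Qed.

Let eulerianB_numer m k : eulerianB m k = (numer m)`_k.
Proof.
have [r H] := trunc_numer m.
by rewrite /eulerianB -/(S m k.+1) H coefD coefXnM ltnSn addr0.
Qed.

Let alg (R : realType) (C P Q e f : R) :
  C != 0 -> P != 0 -> Q != 0 -> f != 0 ->
  e * f / C * Q^-1 = P * (e * (C * (Q * P) / f)^-1).
Proof. by move=> C0 P0 Q0 f0; field; rewrite C0 P0 Q0 f0. Qed.

Let cvg_natX_expr (R : realType) (i : nat) (x : R) : `|x| < 1 ->
  N%:R ^+ i * x ^+ N @[N --> \oo] --> (0 : R).
Proof.
move=> x1; apply/norm_cvg0P.
have [->|x0] := eqVneq x 0.
  rewrite -cvg_shiftS /=.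
  under eq_fun do rewrite exprS mul0r mulr0 normr0.
  exact: cvg_cst.
pose c := - ln `|x|.
have c0 : 0 < c by rewrite oppr_gt0 ln_lt0// normr_gt0 x0.
pose K := expR c * (i.+1)`!%:R / c ^+ i.+1.
apply: (@squeeze_cvgr _ _ _ _ (cst 0) (fun N => K * harmonic N)).
- near=> N; rewrite normr_ge0 /=.
  rewrite normrM !normrX normr_nat.
  have -> : `|x| ^+ N = expR c / expR (c * N.+1%:R).
    rewrite -expRB -natr1 mulrDr mulr1 opprD addrCA subrr addr0.
    by rewrite -mulNr opprK expRM_natr lnK// posrE normr_gt0.
  have Npos : 0 < N.+1%:R :> R by [].
  have cN : 0 < (c * N.+1%:R) ^+ i.+1 / (i.+1)`!%:R.
    by rewrite divr_gt0 ?exprn_gt0 ?mulr_gt0// ltr0n fact_gt0.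
  have le1 : (expR (c * N.+1%:R))^-1 <= ((c * N.+1%:R) ^+ i.+1 / (i.+1)`!%:R)^-1.
    rewrite lef_pV2 ?posrE ?expR_gt0//.
    apply: (le_trans _ (expR_ge1Dxn i _)); first by rewrite lerDr.
    by rewrite mulr_ge0 ?ltW.
  have leN : N%:R ^+ i <= N.+1%:R ^+ i :> R by rewrite lerXn2r ?nnegrE ?ler0n ?ler_nat.
  have -> : K * harmonic N =
     N.+1%:R ^+ i * (expR c * ((c * N.+1%:R) ^+ i.+1 / (i.+1)`!%:R)^-1).
    rewrite /K /harmonic exprMn [N.+1%:R ^+ i.+1]exprS.
    by apply: alg; rewrite ?expf_neq0 ?(gt_eqF c0) ?pnatr_eq0// -lt0n fact_gt0.
  rewrite ler_pM ?exprn_ge0 ?ler0n// ?divr_ge0 ?expR_ge0//.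
  by rewrite ler_pM2l ?expR_gt0.
- exact: cvg_cst.
- rewrite -(mulr0 K); apply: cvgMl_tmp; exact: cvg_harmonic.
Unshelve. all: by end_near.
Qed.

Lemma eulerianB_gf (R : realType) (m : nat) (x : R) : `|x| < 1 ->
  series (fun j => (2 * j + 1)%:R ^+ m * x ^+ j) @ \oo -->
  (1 - x) ^- m.+1 * \sum_(k < m.+1) (eulerianB m k)%:~R * x ^+ k.
Proof.
move=> x1; have [r Hr] := trunc_numer m.
pose ev (p : {poly int}) : R := (map_poly intr p).[x].
have x1N : (1 - x) ^+ m.+1 != 0.
  by rewrite expf_neq0// subr_eq0 eq_sym lt_eqF// (le_lt_trans (ler_norm _)).
have -> : series (fun j => (2 * j + 1)%:R ^+ m * x ^+ j) =
  (fun N => (1 - x) ^- m.+1 *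
     (ev (numer m) + \sum_(i < size r) ev r`_i * (N%:R ^+ i * x ^+ N))).
  apply/funext => N; apply: (mulfI x1N); rewrite mulrA divff// mul1r.
  have -> : series (fun j => (2 * j + 1)%:R ^+ m * x ^+ j) N = ev (S m N).
    rewrite /ev /S poly_def rmorph_sum horner_sum /series /= big_mkord.
    apply: eq_bigr => i _.
    by rewrite map_polyZ hornerZ /= map_polyXn hornerXn -natrX.
  have -> : (1 - x) ^+ m.+1 = ev ((1 - 'X) ^+ m.+1).
    by rewrite /ev rmorphXn rmorphB rmorph1 /= map_polyX horner_exp !hornerE.
  rewrite -hornerM -rmorphM Hr rmorphD rmorphM hornerD hornerM /=.
  congr (_ + _); rewrite map_polyXn hornerXn (horner_coef r) rmorph_sum horner_sum.
  rewrite mulr_sumr; apply: eq_bigr => i _.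
  by rewrite rmorphM rmorphXn rmorph_nat hornerM horner_exp -polyC_natr hornerC mulrC mulrA.
have -> : \sum_(k < m.+1) (eulerianB m k)%:~R * x ^+ k = ev (numer m).
  rewrite /ev (horner_coef_wide x (n := m.+1)); last first.
    by rewrite (leq_trans (size_poly _ _)).
  by apply: eq_bigr => k _; rewrite eulerianB_numer coef_map.
apply: cvgMl_tmp; rewrite -[X in _ --> X]addr0; apply: cvgD; first exact: cvg_cst.
rewrite -[X in _ --> X](@big1 R 0 +%R 'I_(size r) (index_enum _) xpredT (fun=> 0))//.
apply: cvg_big => [|i _]; first exact: add_continuous.
  rewrite -(mulr0 (ev r`_i)); apply: cvgMl_tmp.
exact: cvg_natX_expr.
Qed.

Lemma eulerianB_unique (R : realType) (m : nat) (E : nat -> R) :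
  (forall x : R, `|x| < 1 ->
    series (fun j => (2 * j + 1)%:R ^+ m * x ^+ j) @ \oo -->
    (1 - x) ^- m.+1 * \sum_(k < m.+1) E k * x ^+ k) ->
  forall k, (k <= m)%N -> E k = (eulerianB m k)%:~R.
Proof.
move=> HE k km; pose p := \poly_(k < m.+1) (E k - (eulerianB m k)%:~R).
suff p0 : p = 0.
  by have /eqP := coef0 R k; rewrite -p0 coef_poly ltnS km subr_eq0 => /eqP.
pose s : seq R := mkseq (fun j => j.+2%:R^-1) m.+1.
apply/eqP; apply/negPn/negP => pN0.
have : (size s < size p)%N.
  apply: max_poly_roots => //.
    apply/allP => y /mapP[j _ ->]; set x := j.+2%:R^-1.
    have x1 : `|x| < 1 by rewrite ger0_norm ?invr_ge0// invf_lt1// ltr1n.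
    have x1N : (1 - x) ^- m.+1 != 0.
      by rewrite invr_eq0 expf_neq0// subr_eq0 eq_sym lt_eqF// (le_lt_trans (ler_norm _)).
    have := cvg_lim (@Rhausdorff R) (eulerianB_gf (m := m) x1).
    rewrite (cvg_lim (@Rhausdorff R) (HE x x1)) => /(_ _)/(mulfI x1N) e.
    rewrite /root /p horner_poly; under eq_bigr do rewrite mulrBl.
    by rewrite sumrB e subrr.
  rewrite mkseq_uniq// => i j /invr_inj /eqP; rewrite eqr_nat => /eqP[].
  by [].
by rewrite size_mkseq ltnNge size_poly.
Qed.

End EulerianB.

(* Main.v *)
Require Import Defs.
From mathcomp Require Import all_boot all_order all_algebra perm.
From mathcomp Require Import all_classical all_reals all_analysis measurable_realfun.
From mathcomp Require Import zify ring lra.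

(** Put v = artanh x, so that x = tanh v and dx = (1 - x^2) dv.  Up to explicit
    constants, the two integrands become
      D^(2n-1) sech v / v dv   and   D^(2n) tanh v / v dv   on v > 0.
    This is what the Eulerian numbers are for: since 1 + x and 1 - x are
    e^v / cosh v and e^-v / cosh v, the derivatives of tanh and sech are
    alternating sums of (1 + x)^a (1 - x)^b with Eulerian coefficients; by the
    symmetry of these numbers the terms k and 2n - 1 - k combine into
    (1 - x^2)^k ((1 + x)^N - (1 - x)^N) with N = 2n - 2k - 1 odd, and expanding
    this in powers of x gives the coefficients calC_A and calC_B
    ([tanh_poly_calC], [sech_poly_calC]).

    On the other hand tanh and the derivative of sech have partial fraction
    expansions with poles at +-i a_k, where a_k = (2k + 1) pi / 2
    ([tanh_partial_fractions], [sech_der_partial_fractions]).  Differentiating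
    them termwise ([pole_im_series_iter]) expresses the higher derivatives as
    sums over k of +-Im (a_k - i v)^-m, and
      \int_0^oo Im (a - i v)^-m dv / v = (pi / 2) a^-m.
    So the integrals are the sums of +-a_k^-m, that is, multiples of
    beta(2n) / pi^(2n) and of zeta(2n+1) / pi^(2n+1), with m = 2n and
    m = 2n + 1.

    The partial fractions come from a real form of Herglotz' argument for the
    Poisson kernel K(y, f) = sinh y / (cosh y - cos f).  The value of K at
    (y, f) is the mean of its values at (y/2, f/2) and (y/2, f/2 + pi), and the
    sums of 2y / (y^2 + (f + 2 pi j)^2) over j satisfy the same relation.  Near
    y = 0 the difference is O(y), so that iterating the relation makes it
    vanish ([herglotz_contraction]).  At f = pi/2 the kernel is tanh, and
    its derivative in f is the derivative of sech; working with the latter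
    avoids the expansion of sech itself, which converges only conditionally.

    Sums and integrals are never exchanged: the integrand Im (a - i v)^-m / v
    has an elementary antiderivative ([pole_prim]), the series of these
    antiderivatives is differentiated termwise, and its limits at 0 and at
    infinity follow by dominated convergence for series
    ([pole_series_antiderivative]).  The Lebesgue integral is then computed by
    the fundamental theorem of calculus on an open interval ([FTC_unit_oo]). *)

Set Implicit Arguments.
Unset Strict Implicit.
Unset Printing Implicit Defensive.

Import Order.TTheory GRing.Theory Num.Theory.
Import numFieldNormedType.Exports.
Local Open Scope classical_set_scope.
Local Open Scope ring_scope.

(** * Eulerian numbers of type A *)

Section Descents.
Local Open Scope nat_scope.

(** A permutation read as a word on [nat], so that positions can be shifted
    without changing types. *)
Definition perm_word (m : nat) (s : 'S_m) (p : nat) : nat :=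
  oapp (fun i : 'I_m => s i : nat) 0 (insub p).

Definition word_descents (m : nat) (w : nat -> nat) : nat :=
  \sum_(i < m) ((i.+1 < m) && (w i.+1 < w i)).

Definition insert_max (m i : nat) (w : nat -> nat) (p : nat) : nat :=
  if p < i then w p else if p == i then m else w p.-1.

Lemma perm_wordE m (s : 'S_m) (i : 'I_m) : perm_word s i = s i.
Proof. by rewrite /perm_word valK. Qed.

Lemma perm_word_lt m (s : 'S_m) p : p < m -> perm_word s p < m.
Proof. by move=> pm; rewrite -[p]/(val (Ordinal pm)) perm_wordE. Qed.

Lemma card_descents m (s : 'S_m) : #|descents s| = word_descents m (perm_word s).
Proof.
rewrite -sum1_card big_mkcond /word_descents /=.
rewrite (eq_bigr (fun p : 'I_m * 'I_m =>
  nat_of_bool ((p.2 == p.1.+1 :> nat) && (s p.2 < s p.1)))); last first.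
  by move=> p _; rewrite inE; case: andP.
rewrite -(pair_bigA _ (fun i j : 'I_m => nat_of_bool ((j == i.+1 :> nat) && (s j < s i)))) /=.
apply: eq_bigr => i _; have [im|im] := ltnP i.+1 m => /=; last first.
  by rewrite big1 // => j _; case: eqP => // e; move: (ltn_ord j); rewrite e ltnNge im.
rewrite (bigD1 (Ordinal im)) //= eqxx /= big1 => [|j ji]; last first.
  by case: eqP => // e; case/eqP: ji; apply: val_inj.
by rewrite addn0 -[i.+1]/(val (Ordinal im)) !perm_wordE.
Qed.

Lemma eq_word_descents m w1 w2 : (forall p, p < m -> w1 p = w2 p) ->
  word_descents m w1 = word_descents m w2.
Proof.
move=> e; apply: eq_bigr => i _; case: ltnP => //= im.
by rewrite !e // ltnW.
Qed.

Lemma word_descentsE m w :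
  word_descents m.+1 w = \sum_(0 <= i < m) (w i.+1 < w i).
Proof.
rewrite /word_descents big_ord_recr /= ltnn addn0 big_mkord.
by apply: eq_bigr => i _; rewrite ltnS ltn_ord.
Qed.

(** The slots strictly inside the word, between the two letters of a descent:
    the maximum can be inserted there without changing the number of descents. *)
Definition descent_slot (m : nat) (w : nat -> nat) (i : nat) : bool :=
  [&& 0 < i, i < m & w i < w i.-1].

(** Inner descent slots and descents correspond by [i |-> i - 1]. *)
Lemma sum_descent_slot m w :
  \sum_(i < m.+1) descent_slot m w i = word_descents m w.
Proof.
rewrite big_ord_recl /= add0n; apply: eq_bigr => i _.
by rewrite /descent_slot /bump /= add1n.
Qed.

(** Inserting the maximum at [i] separates the letters at [i - 1] and [i], which
    loses a descent if they formed one, and creates the descent from the maximum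
    to the next letter, unless the maximum comes last. *)
Lemma word_descents_insert m w i : i <= m -> (forall p, p < m -> w p < m) ->
  word_descents m.+1 (insert_max m i w) + descent_slot m w i =
  word_descents m w + (i < m).
Proof.
move=> im wm; rewrite word_descentsE.
case: m im wm => [|m] im wm.
  by rewrite big_nil /word_descents big_ord0 /descent_slot /= andbF.
rewrite word_descentsE.
(* Neighbours left of, right of, at, and just before the inserted maximum. *)
have lo p : p.+1 < i -> insert_max m.+1 i w p.+1 < insert_max m.+1 i w p = (w p.+1 < w p).
  by move=> h; rewrite /insert_max h (ltnW h).
have hi p : i <= p -> insert_max m.+1 i w p.+2 < insert_max m.+1 i w p.+1 = (w p.+1 < w p).
  move=> h; rewrite /insert_max.
  by rewrite !ifF //; apply/negbTE; rewrite -?leqNgt; lia.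
have mid : i < m.+1 -> insert_max m.+1 i w i.+1 < insert_max m.+1 i w i.
  move=> h; rewrite /insert_max ltnn eqxx ifF; last by lia.
    by rewrite ifF ?wm //; lia.
have lst : 0 < i -> insert_max m.+1 i w i < insert_max m.+1 i w i.-1 = false.
  case: i im {lo hi mid} => // i im _; rewrite /insert_max ltnn eqxx /= ltnSn.
  by apply/negbTE; rewrite -leqNgt ltnW // wm.
case: i im lo hi mid lst => [|i] im lo hi mid lst.
  rewrite big_nat_recl // mid // /descent_slot /= addn0 addnC; congr addn.
have -> : \sum_(0 <= p < m.+1) (insert_max m.+1 i.+1 w p.+1 < insert_max m.+1 i.+1 w p)
  = \sum_(0 <= p < i) (w p.+1 < w p) + (i.+1 < m.+1)
    + \sum_(i.+1 <= p < m) (w p.+1 < w p).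
  rewrite (@big_cat_nat _ _ _ i) //= ; last by lia.
  rewrite -addnA; congr (_ + _).
    rewrite !big_mkord; apply: eq_bigr => p _; rewrite lo //.
    by rewrite ltnS.
  rewrite big_ltn // lst // add0n.
  have [h|h] := ltnP i.+1 m.+1; last first.
    by rewrite !big_geq // ltnW.
  rewrite big_ltn // mid //; congr (_ + _).
  rewrite big_add1 /= [LHS]big_nat_cond [RHS]big_nat_cond.
  by apply: eq_bigr => p /andP[/andP[h1 _] _]; rewrite hi.
have [h|h] := ltnP i.+1 m.+1; last first.
  have -> : i = m by lia.
  by rewrite /descent_slot ltnn (@big_geq _ _ _ m.+1) //= !addn0.
rewrite (@big_cat_nat _ _ _ i 0 m) //=.
rewrite [\sum_(i <= _ < m) _]big_ltn; last by exact: h.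
by rewrite /descent_slot h /=; lia.
Qed.

(** The insertions that keep the number [D] of descents are the one at the end
    and those at the [D] descents; all the others create one descent. *)
Lemma count_insertions m w k : (forall p, p < m -> w p < m) ->
  \sum_(i < m.+1) (word_descents m.+1 (insert_max m i w) == k) =
  (word_descents m w == k) * (word_descents m w).+1 +
  ((word_descents m w).+1 == k) * (m - word_descents m w).
Proof.
move=> wm; set D := word_descents m w.
have sb := sum_descent_slot m w; rewrite -/D in sb.
have sc : \sum_(i < m.+1) ((i < m) && ~~ descent_slot m w i) = m - D.
  have : \sum_(i < m.+1) ((i < m) && ~~ descent_slot m w i) + \sum_(i < m.+1) descent_slot m w
    i = m.
    rewrite -big_split /= big_ord_recr /= ltnn /=.
    rewrite {3}/descent_slot ltnn andbF !addn0.
    rewrite -[RHS]card_ord -sum1_card; apply: eq_bigr => i _.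
    by rewrite ltn_ord /=; case: descent_slot.
  by rewrite sb; lia.
have sm : \sum_(i < m.+1) (i == m :> nat) = 1.
  by rewrite big_ord_recr /= eqxx big1 // => i _; rewrite ltn_eqF.
have sd : \sum_(i < m.+1) (descent_slot m w i + (i == m :> nat)) = D.+1.
  by rewrite big_split /= sb sm addn1.
rewrite -sc -{1}sd !big_distrr -big_split /=.
apply: eq_bigr => i _.
have := @word_descents_insert m w i (ltn_ord i) wm; rewrite -/D.
have : descent_slot m w i -> i < m by case/and3P.
have := ltn_ord i.
by case: descent_slot => [|] ; case: (ltngtP i m); case: eqP => ?; case: eqP => ?; case: eqP; lia.
Qed.

Lemma perm_word_lift m (s : 'S_m) (i : 'I_m.+1) p : p < m.+1 ->
  perm_word (lift_perm i ord_max s) p = insert_max m i (perm_word s) p.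
Proof.
move=> pm; rewrite -[p]/(val (Ordinal pm)) perm_wordE.
case: (unliftP i (Ordinal pm)) => [j|] ->.
  rewrite lift_perm_lift lift_max /insert_max /= /bump.
  case: (leqP i j) => ij; rewrite ?add0n ?add1n; last by rewrite ij perm_wordE.
  by rewrite ltnNge leqW //= gtn_eqF ?ltnS //= perm_wordE.
by rewrite lift_perm_id /insert_max /= ltnn eqxx.
Qed.

(** A permutation of [m + 1] letters is obtained exactly once by inserting the
    maximum: the position of the maximum gives [i], and deleting it gives [s]. *)
Lemma lift_perm_max_bij m :
  bijective (fun x : 'I_m.+1 * 'S_m => lift_perm x.1 ord_max x.2).
Proof.
apply: inj_card_bij => [[i s] [j t] /= e|]; last first.
  by rewrite card_prod !card_Sn card_ord factS.
have ij : i = j.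
  by apply: (@perm_inj _ (lift_perm j ord_max t)); rewrite lift_perm_id -e lift_perm_id.
congr (_, _) => //; subst j; apply/permP => k.
by apply: (@lift_inj _ ord_max); rewrite -!(lift_perm_lift i) e.
Qed.

Lemma eulerianA_sum m k :
  eulerianA m k = \sum_(s : 'S_m) (word_descents m (perm_word s) == k).
Proof.
rewrite /eulerianA -sum1_card big_mkcond; apply: eq_bigr => s _.
by rewrite unfold_in /in_set asboolb card_descents; case: eqP.
Qed.

(** Building permutations by insertion of the maximum, the contributions of each
    smaller permutation are those of [count_insertions]. *)
Lemma eulerianA_rec m k :
  eulerianA m.+1 k =
  k.+1 * eulerianA m k + (if k is k'.+1 then (m - k') * eulerianA m k' else 0).
Proof.
rewrite eulerianA_sum (reindex _ (onW_bij _ (lift_perm_max_bij m))) /=.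
rewrite -(pair_bigA _ (fun (i : 'I_m.+1) (s : 'S_m) =>
  nat_of_bool (word_descents m.+1 (perm_word (lift_perm i ord_max s)) == k))) /=.
rewrite exchange_big /= !eulerianA_sum big_distrr /=.
have -> : (if k is k'.+1 then (m - k') * eulerianA m k' else 0) =
  \sum_(s : 'S_m) ((word_descents m (perm_word s)).+1 == k) * (m - word_descents m (perm_word s)).
  case: k => [|k]; first by rewrite big1.
  rewrite eulerianA_sum big_distrr; apply: eq_bigr => s _ /=.
  by rewrite eqSS; case: eqP => [->|_]; rewrite ?muln0 ?muln1 ?mul1n.
rewrite -big_split; apply: eq_bigr => s _ /=.
under eq_bigr => i _ do
  rewrite (eq_word_descents (fun p pm => perm_word_lift s i pm)).
rewrite count_insertions; last by move=> p; exact: perm_word_lt.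
by congr (_ + _); case: eqP => [->|_]; rewrite ?mul0n ?mul1n ?muln0 ?muln1.
Qed.

Lemma eulerianA0 k : eulerianA 0 k = (k == 0).
Proof.
rewrite eulerianA_sum; under eq_bigr do rewrite /word_descents big_ord0.
by rewrite sum_nat_const card_Sn mul1n eq_sym.
Qed.

Lemma eulerianA_large m k : 0 < m -> m <= k -> eulerianA m k = 0.
Proof.
case: m => // m _; elim: m k => [|m IH] [|k] // km.
  by rewrite eulerianA_rec !eulerianA0 /=; case: k {km} => [|k]; rewrite ?muln0.
by rewrite eulerianA_rec !IH ?muln0 // ltnW.
Qed.

(** The recurrence is invariant under [k |-> m - 1 - k], which exchanges its two
    terms. *)
Lemma eulerianA_sym m k : k < m -> eulerianA m (m.-1 - k) = eulerianA m k.
Proof.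
case: m => // m; rewrite ltnS /=; elim: m k => [|m IH] k km.
  by move: km; rewrite leqn0 => /eqP ->.
case: k km => [|k] km.
  rewrite subn0 (eulerianA_rec _ m.+1) (eulerianA_rec m.+1 0) (@eulerianA_large m.+1 m.+1) //
    muln0 add0n addn0 mul1n.
  by rewrite subSnn mul1n -(IH 0) // subn0.
rewrite subSS.
rewrite [RHS]eulerianA_rec eulerianA_rec.
have [->|kltm] := eqVneq k m.
  rewrite subnn subSnn (@eulerianA_large m.+1 m.+1) // muln0 add0n !mul1n addn0.
  by rewrite -[in RHS](IH m) // subnn.
have hk : k < m by lia.
have -> : m - k = (m - k.+1).+1 by lia.
rewrite IH //; have -> : (m - k.+1).+1 = m - k by lia.
rewrite IH; last by lia.
by rewrite addnC; congr (_ * _ + _ * _); lia.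
Qed.

End Descents.

(** * Eulerian numbers of type B *)

Lemma coef_expr_1subX (n i : nat) :
  ((1 - 'X) ^+ n : {poly int})`_i = (-1) ^+ i * 'C(n, i)%:Z.
Proof.
elim: n i => [|n IH] [|i]; rewrite ?expr0 ?coef1 ?bin0 ?mulr1 ?bin0n ?mulr0 //.
  by rewrite exprS mulrBl mul1r coefB coefXM IH /= subr0 bin0.
rewrite exprS mulrBl mul1r coefB coefXM /= !IH binS PoszD exprS; ring.
Qed.

Lemma eulerianB_sum (m k : nat) :
  eulerianB m k =
  \sum_(i < k.+1) (-1) ^+ i * 'C(m.+1, i)%:Z * (2 * (k - i)%:Z + 1) ^+ m.
Proof.
rewrite /eulerianB coefM; apply: eq_bigr => i _.
rewrite coef_expr_1subX coef_poly ltnS leq_subr; congr (_ * _).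
by rewrite -natz natrX natz PoszD PoszM.
Qed.

Lemma bin_ratio (n i : nat) : (i%:Z + 1) * 'C(n, i.+1)%:Z = (n%:Z - i%:Z) * 'C(n, i)%:Z.
Proof.
have [le_in|lt_ni] := leqP i n; last by rewrite !bin_small ?mulr0 // ltnW.
rewrite subzn // (_ : i%:Z + 1 = i.+1%:Z); last by lia.
by rewrite -!PoszM mul_bin_left.
Qed.

Lemma eulerianB_rec0 m : eulerianB m.+1 0 = eulerianB m 0.
Proof. by rewrite !eulerianB_sum !big_ord1 subnn !mulr0 add0r !expr1n !bin0. Qed.

(** In the explicit sum for the numbers, Pascal's rule splits the binomial
    coefficients of the left-hand side, and [bin_ratio] matches the
    coefficients, which depend on the summation index, with those of the
    right-hand side. *)
Lemma eulerianB_recS m k :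
  eulerianB m.+1 k.+1 = (2 * k.+1%:Z + 1) * eulerianB m k.+1
    + (2 * (m%:Z - k%:Z) + 1) * eulerianB m k.
Proof.
rewrite !eulerianB_sum [in LHS]big_ord_recl [X in _ = _ * X + _]big_ord_recl.
rewrite mulrDr -addrA; congr (_ + _).
  by rewrite !bin0 expr0 !mul1r subn0 exprS.
rewrite !mulr_sumr -big_split /=; apply: eq_bigr => i _.
rewrite /bump /= add1n subSS; have le_ik : (i <= k)%N by rewrite -ltnS.
rewrite -subzn // exprS [in 'C(_, _)]binS PoszD exprS.
have e := bin_ratio m.+1 i.
set x := _ ^+ m; set s := _ ^+ i.
transitivity (- s * x * ((2 * (k%:Z - i%:Z) + 1) * ('C(m.+1, i.+1)%:Z + 'C(m.+1, i)%:Z))).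
  by ring.
transitivity (- s * x * ((2 * k.+1%:Z + 1) * 'C(m.+1, i.+1)%:Z
   - (2 * (m%:Z - k%:Z) + 1) * 'C(m.+1, i)%:Z)); last by ring.
congr (_ * _); move: e; rewrite -!natz -![_.+1%:R]natr1; move: ('C(m.+1, i.+1)%:R) => u.
by move: ('C(m.+1, i)%:R) => v e; lia.
Qed.

Lemma eulerianB0 k : eulerianB 0 k = (k == 0%N)%:Z.
Proof.
rewrite /eulerianB expr1 mulrBl mul1r coefB coefXM !coef_poly.
by case: k => [|k] //=; rewrite ltnSn leqnSn ?ltnS ?leqnn ?expn0.
Qed.

Lemma eulerianB_large m k : (m < k)%N -> eulerianB m k = 0.
Proof.
elim: m k => [|m IH] [|k] // mk; first by rewrite eulerianB0.
by rewrite eulerianB_recS !IH ?mulr0 ?addr0 // ltnW.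
Qed.

(** As in type A, the recurrence exchanges its two terms under
    [k |-> m - k]. *)
Lemma eulerianB_sym m k : (k <= m)%N -> eulerianB m (m - k) = eulerianB m k.
Proof.
elim: m k => [|m IH] [|k] // km.
  rewrite subn0 eulerianB_recS eulerianB_rec0 eulerianB_large // mulr0 add0r subrr.
  by rewrite mulr0 add0r mul1r -(IH 0%N) // subn0.
rewrite subSS [RHS]eulerianB_recS.
have [ekm|kltm] := eqVneq k m.
  subst k; rewrite subnn eulerianB_rec0 (@eulerianB_large m m.+1) // mulr0 add0r subrr.
  by rewrite mulr0 add0r mul1r -[in RHS](IH m) // subnn.
have hk : (k < m)%N by lia.
have e1 : (m - k = (m - k.+1).+1)%N by lia.
rewrite e1 eulerianB_recS -e1 IH; last by lia.
rewrite IH //; rewrite addrC -!subzn //.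
by congr (_ * _ + _ * _); lia.
Qed.

(** The Eulerian polynomial evaluated at [- (1 - x) / (1 + x)] and made
    homogeneous of degree [m]; when x = tanh v this quotient is [- e^(-2v)], the
    point at which the generating functions give the derivatives of tanh and
    sech. *)
Definition eulerian_poly (R : comNzRingType) (E : nat -> R) (m : nat) : {poly R} :=
  \sum_(k < m.+1) ((-1) ^+ k * E k) *: ((1 + 'X) ^+ (m - k) * (1 - 'X) ^+ k).

(** The operator (1 - X^2) d/dX is d/dv for X = tanh v.  It multiplies
    (1 + X)^a (1 - X)^b by a (1 - X) - b (1 + X), so that a recurrence between two
    rows of coefficients becomes a first-order differential relation.  The
    constants [p], [q], [r] cover the two Eulerian recurrences at once. *)
Lemma eulerian_poly_rec (R : comNzRingType) (p q r : R) (E E' : nat -> R) (m : nat) :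
  E m.+1 = 0 -> E' 0%N = q * E 0%N ->
  (forall k, (k <= m)%N ->
    E' k.+1 = (p * k.+1%:R + q) * E k.+1 + (p * (m - k)%:R + r) * E k) ->
  eulerian_poly E' m.+1 =
  - (p *: ((1 - 'X ^+ 2) * (eulerian_poly E m)^`())) +
    (q *: (1 + 'X) - r *: (1 - 'X)) * eulerian_poly E m.
Proof.
move=> Em E0 ES; rewrite /eulerian_poly.
set y : {poly R} := 1 + 'X; set z : {poly R} := 1 - 'X.
have dyz (a b : nat) : (1 - 'X ^+ 2) * (y ^+ a * z ^+ b)^`() =
    (y ^+ a * z ^+ b) * (a%:R * z - b%:R * y).
  have -> : 1 - 'X ^+ 2 = y * z by rewrite /y /z; ring.
  rewrite derivM !deriv_exp /y /z !derivD derivN derivX -/y -/z.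
  have dy : (1 : {poly R})^`() = 0 by rewrite -polyC1 derivC.
  rewrite dy !add0r mul1r mulN1r.
  have h (u : {poly R}) (c : nat) : u * (u ^+ c.-1 *+ c) = c%:R * u ^+ c.
    case: c => [|c] /=; first by rewrite mulr0n mulr0 mul0r.
    by rewrite -mulr_natl mulrCA exprS.
  transitivity ((y * (y ^+ a.-1 *+ a)) * (z ^+ b * z) - (z * (z ^+ b.-1 *+ b)) * (y ^+ a * y)).
    by rewrite mulNrn; ring.
  by rewrite !h; ring.
rewrite (raddf_sum (@deriv R)) !mulr_sumr scaler_sumr -sumrN -big_split /=.
transitivity (\sum_(k < m.+1) ((-1) ^+ k * E k) *: (y ^+ (m - k) * z ^+ k) *
   ((p * k%:R + q) *: y - (p * (m - k)%:R + r) *: z)); last first.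
  apply: eq_bigr => k _; rewrite derivZ -!scalerAr dyz -!mul_polyC.
  by rewrite !(polyCD, polyCM, polyC_natr); ring.
rewrite big_ord_recl /=.
under eq_bigr => k _.
  have lekm : (k <= m)%N by rewrite -ltnS.
  rewrite /bump /= add1n ES // mulrDr scalerDl; over.
rewrite big_split /= addrA.
rewrite E0 expr0 mul1r subn0.
have -> : (q * E 0%N) *: (y ^+ m.+1 * 1) + \sum_(i < m.+1) ((-1) ^+ i.+1 *
  ((p * i.+1%:R + q) * E i.+1)) *: (y ^+ (m.+1 - i.+1) * z ^+ i.+1) =
  \sum_(i < m.+2) ((-1) ^+ i * ((p * i%:R + q) * E i)) *: (y ^+ (m.+1 - i) * z ^+ i).
  by rewrite [RHS]big_ord_recl /= mulr0 add0r expr0 mul1r subn0.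
rewrite big_ord_recr /= Em !mulr0 scale0r addr0 -big_split /=.
apply: eq_bigr => k _; have lekm : (k <= m)%N by rewrite -ltnS.
rewrite subSS subSn // -!mul_polyC.
by rewrite !(polyCD, polyCM, polyC_natr, polyCN, polyC_exp, polyC1) !exprS; ring.
Qed.

(** The number of terms is even, so the terms at [k] and [2n - 1 - k] carry
    opposite signs. *)
Lemma sym_alternating_sum (R : comNzRingType) (w : nat -> R) (n : nat) (y z : R) :
  (forall k, (k < 2 * n)%N -> w (2 * n - 1 - k)%N = w k) ->
  \sum_(k < 2 * n) (-1) ^+ k * w k * (y ^+ (2 * n - 1 - k) * z ^+ k) =
  \sum_(k < n) (-1) ^+ k * w k *
     ((y * z) ^+ k * (y ^+ (2 * n - 2 * k - 1) - z ^+ (2 * n - 2 * k - 1))).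
Proof.
move=> ws.
rewrite -(big_mkord xpredT (fun k => (-1) ^+ k * w k * (y ^+ (2 * n - 1 - k) * z ^+ k))).
rewrite (@big_cat_nat _ _ _ n) //=; last by lia.
rewrite [X in _ + X](_ : _ = \sum_(0 <= k < n) - ((-1) ^+ k * w k * (y ^+ k * z ^+ (2 * n - 1 -
  k)))).
  rewrite -big_split /= big_mkord; apply: eq_bigr => k _; have := ltn_ord k => kn.
  have -> : (2 * n - 1 - k = k + (2 * n - 2 * k - 1))%N by lia.
  by rewrite exprMn !exprD; ring.
rewrite big_nat_rev /= -{1}[n]add0n big_addn.
have -> : (2 * n - n = n)%N by lia.
rewrite !big_mkord; apply: eq_bigr => k _; have := ltn_ord k => kn.
have -> : (n + 2 * n - (k + n).+1 = 2 * n - 1 - k)%N by lia.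
rewrite ws; last by lia.
have -> : (2 * n - 1 - (2 * n - 1 - k) = k)%N by lia.
have -> : (-1) ^+ (2 * n - 1 - k) = - (-1) ^+ k :> R.
  by rewrite -signr_odd -[in RHS]signr_odd (_ : odd _ = ~~ odd k) ?signrN //; lia.
by ring.
Qed.

Lemma sum_even_odd (V : nmodType) (F : nat -> V) (K : nat) :
  \sum_(0 <= i < K + K) F i = \sum_(0 <= s < K) (F s.*2 + F s.*2.+1).
Proof.
elim: K => [|K IH]; first by rewrite !big_nil.
by rewrite addSn addnS !big_nat_recr //= IH -addrA -addnn.
Qed.

Lemma odd_binomial_diff (R : comNzRingType) (M : nat) (x : R) (N := (2 * M + 1)%N) :
  (1 + x) ^+ N - (1 - x) ^+ N =
  2 * x * \sum_(s < M.+1) 'C(N, 2 * s + 1)%:R * x ^+ (2 * s).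
Proof.
rewrite exprDn exprBn -sumrB /=.
rewrite (eq_bigr (fun i : 'I_N.+1 => (1 - (-1) ^+ i) * x ^+ i * 'C(N, i)%:R)); last first.
  move=> i _; rewrite !expr1n -[_ *+ _ in X in X - _]mulr_natr -[_ *+ _ in X in _ - X]mulr_natr.
  by ring.
rewrite -(big_mkord xpredT (fun i => (1 - (-1) ^+ i) * x ^+ i * 'C(N, i)%:R)).
have -> : N.+1 = (M.+1 + M.+1)%N by rewrite /N; lia.
rewrite sum_even_odd big_mkord mulr_sumr; apply: eq_bigr => s _.
rewrite -[s.*2.+1]addn1 -!mul2n.
have e0 : (-1) ^+ (2 * s) = 1 :> R by rewrite mulnC exprM sqrr_sign.
rewrite [(-1) ^+ (2 * s + 1)]exprD e0 [x ^+ (2 * s + 1)]exprD !expr1.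
by ring.
Qed.

(** The product of the binomial expansion of (1 - x^2)^k with the sum over odd
    binomial coefficients, collected by powers of x^2.  The terms with [i > t]
    have a negative lower index and vanish. *)
Lemma binz_expansion (R : comNzRingType) (n k : nat) (x : R) : (k < n)%N ->
  (1 - x ^+ 2) ^+ k * \sum_(s < n - k) 'C(2 * n - 2 * k - 1, 2 * s + 1)%:R * x ^+ (2 * s) =
  \sum_(0 <= t < n) (\sum_(0 <= i < k.+1) (-1) ^+ i * 'C(k, i)%:Z *
      (binz (2 * n - 2 * k - 1) ((2 * t)%N%:Z - (2 * i)%N%:Z + 1))%:Z)%:~R * x ^+ (2 * t).
Proof.
move=> kn; set N := (2 * n - 2 * k - 1)%N.
transitivity (\sum_(0 <= i < k.+1) ((-1) ^+ i * 'C(k, i)%:Z)%:~R *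
   \sum_(0 <= t < n) (binz N ((2 * t)%N%:Z - (2 * i)%N%:Z + 1))%:~R * x ^+ (2 * t)); last first.
  rewrite (eq_bigr _ (fun i _ => mulr_sumr _ _ _ _)) exchange_big /=.
  apply: eq_bigr => t _; rewrite rmorph_sum mulr_suml; apply: eq_bigr => i _.
  by rewrite [in RHS]rmorphM /= mulrA.
rewrite exprBn mulr_suml big_mkord; apply: eq_bigr => i _.
have := ltn_ord i => ik; rewrite expr1n mulr1 -mulr_natl -!mulrA.
have -> : ((-1) ^+ i * 'C(k, i)%:Z)%:~R = (-1) ^+ i * 'C(k, i)%:R :> R.
  by rewrite rmorphM /= rmorphXn /= rmorphN1.
rewrite mulrCA -!mulrA; congr (_ * (_ * _)).
have -> : \sum_(0 <= t < n) (binz N ((2 * t)%N%:Z - (2 * i)%N%:Z + 1))%:~R * x ^+ (2 * t) =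
   \sum_(0 <= s < n - i) 'C(N, 2 * s + 1)%:R * x ^+ (2 * (s + i)) :> R.
  rewrite (@big_cat_nat _ _ _ i) //=; last by lia.
  rewrite big_nat big1 ?add0r => [|t /andP[_ ti]]; last first.
    case e : ((2 * t)%N%:Z - (2 * i)%N%:Z + 1) => [j|j]; first by lia.
    by rewrite mul0r.
  rewrite -{1}[nat_of_ord i]add0n big_addn; apply: eq_bigr => s _.
  by rewrite (_ : _ + 1 = (2 * s + 1)%N%:Z) //; lia.
rewrite (@big_cat_nat _ _ _ (n - k)) //=; last by lia.
rewrite [X in _ = _ + X]big_nat [X in _ = _ + X]big1 ?addr0; last first.
  by move=> s /andP[h _]; rewrite bin_small ?mul0r // /N; lia.
rewrite big_mkord mulr_sumr; apply: eq_bigr => s _.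
by rewrite mulnDr exprD -exprM; ring.
Qed.

(** * Differentiation rules and mean value bounds *)

Section DerivativeRules.
Variable R : realType.
Implicit Types (f g : R -> R) (x a b c : R).

Lemma derD f g x a b : is_derive x 1 f a -> is_derive x 1 g b ->
  is_derive x 1 (fun t => f t + g t) (a + b).
Proof. exact: is_deriveD. Qed.

Lemma derN f x a : is_derive x 1 f a -> is_derive x 1 (fun t => - f t) (- a).
Proof. exact: is_deriveN. Qed.

Lemma derB f g x a b : is_derive x 1 f a -> is_derive x 1 g b ->
  is_derive x 1 (fun t => f t - g t) (a - b).
Proof. exact: is_deriveB. Qed.

Lemma derM f g x a b : is_derive x 1 f a -> is_derive x 1 g b ->
  is_derive x 1 (fun t => f t * g t) (a * g x + f x * b).
Proof.
move=> fa gb; apply: is_derive_eq.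
by rewrite addrC; congr (_ + _); rewrite mulrC.
Qed.

Lemma der_cst c x : is_derive x 1 (fun=> c) (0 : R).
Proof. exact: is_derive_cst. Qed.

Lemma der_id x : is_derive x 1 (fun t => t) (1 : R).
Proof. exact: is_derive_id. Qed.

Lemma der_comp f g x a b : is_derive (g x) 1 f a -> is_derive x 1 g b ->
  is_derive x 1 (fun t => f (g t)) (a * b).
Proof. by move=> fa gb; have := @is_derive1_comp R f g x a b fa gb. Qed.

Lemma derV f x a : f x != 0 -> is_derive x 1 f a ->
  is_derive x 1 (fun t => (f t)^-1) (- a / f x ^+ 2).
Proof.
move=> f0 [df <-]; apply: DeriveDef; first exact: derivableV.
by rewrite deriveV // /GRing.scale /= mulrC mulNr mulrN.
Qed.

Lemma der_eq f x a b : is_derive x 1 f a -> a = b -> is_derive x 1 f b.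
Proof. by move=> h <-. Qed.

Lemma derXS f n x a : is_derive x 1 f a ->
  is_derive x 1 (fun t => f t ^+ n.+1) (n.+1%:R * f x ^+ n * a).
Proof.
move=> fa; elim: n => [|n IH].
  by rewrite expr0 !mul1r.
have -> : (fun t => f t ^+ n.+2) = (fun t => f t * f t ^+ n.+1).
  by apply/funext => t; rewrite exprS.
apply: der_eq (derM fa IH) _.
by rewrite -(natr1 n.+1) !exprS; ring.
Qed.

Lemma der_uniq f x a b : is_derive x 1 f a -> is_derive x 1 f b -> a = b.
Proof. by move=> [_ <-] [_ <-]. Qed.

Lemma der_cont f x a : is_derive x 1 f a -> {for x, continuous f}.
Proof. by move=> [df _]; exact/differentiable_continuous/derivable1_diffP. Qed.

Lemma derivative_cont f g (A : set R) : (forall t : R, is_derive t 1 f (g t)) ->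
  {within A, continuous f}.
Proof. by move=> df; apply: continuous_subspaceT => t; apply: der_cont. Qed.

(** Climbing from a function to its antiderivative vanishing at 0 turns a
    Taylor inequality into the one of next order. *)
Lemma ge0_of_derivative f g x : 0 <= x -> f 0 = 0 ->
  (forall t : R, is_derive t 1 f (g t)) ->
  (forall t, 0 <= t <= x -> 0 <= g t) -> 0 <= f x.
Proof.
move=> x0 f0 df g0.
have cf : {within `[0, x], continuous f}.
  exact: derivative_cont df.
have [c] := @MVT_segment R f g 0 x x0 (fun t _ => df t) cf.
by rewrite f0 !subr0 in_itv /= => /g0 gc ->; rewrite mulr_ge0.
Qed.

Lemma mean_value_bound f g x y C :
  (forall t : R, is_derive t 1 f (g t)) ->
  (forall t, Num.min x y <= t <= Num.max x y -> `|g t| <= C) ->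
  `|f y - f x| <= C * `|y - x|.
Proof.
wlog xy : x y / x <= y.
  move=> W df gC; have [xy|/ltW xy] := leP x y; first exact: W.
  by rewrite distrC (distrC y x); apply: W => // t; rewrite minC maxC; exact: gC.
rewrite min_l // max_r // => df gC.
have cf : {within `[x, y], continuous f}.
  exact: derivative_cont df.
have [c] := @MVT_segment R f g x y xy (fun t _ => df t) cf.
by rewrite in_itv /= => /gC cC ->; rewrite normrM ler_wpM2r.
Qed.

End DerivativeRules.

(** * Hyperbolic functions and elementary inequalities *)

Section Hyperbolic.
Variable R : realType.
Implicit Types x y t f : R.

Definition cosh y : R := (expR y + expR (- y)) / 2.
Definition sinh y : R := (expR y - expR (- y)) / 2.

Lemma der_expRN t : is_derive t 1 (fun s => expR (- s)) (- expR (- t)).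
Proof.
apply: der_eq (der_comp (is_derive_expR _) (derN (der_id t))) _.
by rewrite mulrN1.
Qed.

Lemma der_cosh t : is_derive t 1 cosh (sinh t).
Proof.
apply: der_eq (derM (derD (is_derive_expR t) (der_expRN t)) (der_cst _ _)) _.
by rewrite mulr0 addr0.
Qed.

Lemma der_sinh t : is_derive t 1 sinh (cosh t).
Proof.
apply: der_eq (derM (derB (is_derive_expR t) (der_expRN t)) (der_cst _ _)) _.
by rewrite mulr0 addr0 opprK.
Qed.

Lemma cosh0 : cosh 0 = 1. Proof. by rewrite /cosh oppr0 expR0; field. Qed.
Lemma sinh0 : sinh 0 = 0. Proof. by rewrite /sinh oppr0 subrr mul0r. Qed.

Lemma cosh2Bsinh2 y : cosh y ^+ 2 - sinh y ^+ 2 = 1.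
Proof.
have := expRxMexpNx_1 y; rewrite /cosh /sinh => e.
transitivity (expR y * expR (- y)); first by field.
exact: e.
Qed.

Lemma cosh_half y : cosh y = 2 * cosh (y / 2) ^+ 2 - 1.
Proof.
have e := expRxMexpNx_1 (y / 2); rewrite /cosh.
have -> : expR y = expR (y / 2) ^+ 2 by rewrite expr2 -expRD -splitr.
have -> : expR (- y) = expR (- (y / 2)) ^+ 2 by rewrite expr2 -expRD -opprD -splitr.
transitivity (2 * ((expR (y / 2) + expR (- (y / 2))) / 2) ^+ 2
  - expR (y / 2) * expR (- (y / 2))); first by field.
by rewrite e.
Qed.

Lemma sinh_half y : sinh y = 2 * sinh (y / 2) * cosh (y / 2).
Proof.
rewrite /cosh /sinh.
have -> : expR y = expR (y / 2) ^+ 2 by rewrite expr2 -expRD -splitr.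
have -> : expR (- y) = expR (- (y / 2)) ^+ 2 by rewrite expr2 -expRD -opprD -splitr.
by field.
Qed.

Lemma cosh_gt0 y : 0 < cosh y.
Proof. by rewrite divr_gt0 // addr_gt0 // expR_gt0. Qed.

Lemma sinh_ge0 y : 0 <= y -> 0 <= sinh y.
Proof.
move=> y0; apply: (ge0_of_derivative y0 sinh0 der_sinh) => t _.
exact/ltW/cosh_gt0.
Qed.

Lemma cosh_ge1 y : 0 <= y -> 1 <= cosh y.
Proof.
move=> y0; rewrite -subr_ge0.
apply: (@ge0_of_derivative R (fun t => cosh t - 1) sinh) => [//||t|t /andP[t0 _]].
- by rewrite cosh0 subrr.
- by apply: der_eq (derB (der_cosh t) (der_cst _ _)) _; rewrite subr0.
- exact: sinh_ge0.
Qed.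

Lemma sinh_geid y : 0 <= y -> y <= sinh y.
Proof.
move=> y0; rewrite -subr_ge0.
apply: (@ge0_of_derivative R (fun t => sinh t - t) (fun t => cosh t - 1) y) => [//||t|t
  /andP[t0 _]].
- by rewrite sinh0 subrr.
- exact: derB (der_sinh t) (der_id _).
- by rewrite subr_ge0 cosh_ge1.
Qed.

Lemma der_monomial (c : R) n t :
  is_derive t 1 (fun s => c * s ^+ n.+1) (c * n.+1%:R * t ^+ n).
Proof.
by apply: der_eq (derM (der_cst c t) (derXS n (der_id t))) _; ring.
Qed.

Lemma cosh_ge2 y : 0 <= y -> 1 + y ^+ 2 / 2 <= cosh y.
Proof.
move=> y0; rewrite -subr_ge0.
apply: (@ge0_of_derivative R (fun t => cosh t - (1 + t ^+ 2 / 2)) (fun t => sinh t - t) y) =>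
  [//||t|t /andP[t0 _]].
- by rewrite cosh0 expr0n /= mul0r addr0 subrr.
- apply: der_eq (derB (der_cosh t) (derD (der_cst _ _)
    (derM (derXS 1 (der_id t)) (der_cst _ _)))) _.
  by rewrite expr1; field.
- by rewrite subr_ge0 sinh_geid.
Qed.

Lemma cosh_le3 y : 0 <= y <= 1 -> cosh y <= 3.
Proof.
move=> /andP[y0 y1]; rewrite /cosh ler_pdivrMr //.
have e1 : expR (- y) <= 1 by rewrite -expR0 ler_expR oppr_le0.
suff : expR y <= 4 by lra.
have -> : expR y = (expR (- (y / 2)) ^+ 2)^-1.
  by rewrite expr2 -expRD -opprD -splitr expRN invrK.
have h : 1 / 2 <= expR (- (y / 2)).
  by apply: le_trans (expR_ge1Dx _); lra.
rewrite -[4]invrK lef_pV2 ?posrE ?exprn_gt0 ?expR_gt0 ?invr_gt0 //.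
by have : (1 / 2) ^+ 2 <= expR (- (y / 2)) ^+ 2; [rewrite lerXn2r ?nnegrE //; lra | lra].
Qed.

Lemma sinh_le3 y : 0 <= y <= 1 -> sinh y <= 3 * y.
Proof.
move=> /andP[y0 y1]; rewrite -subr_ge0.
apply: (@ge0_of_derivative R (fun t => 3 * t - sinh t) (fun t => 3 - cosh t) y) => [//||t|t
  /andP[t0 ty]].
- by rewrite mulr0 sinh0 subrr.
- apply: der_eq (derB (derM (der_cst _ _) (der_id t)) (der_sinh t)) _; ring.
- by rewrite subr_ge0 cosh_le3 // t0 (le_trans ty).
Qed.

Lemma cosh_le y : 0 <= y <= 1 -> cosh y <= 1 + 3 / 2 * y ^+ 2.
Proof.
move=> /andP[y0 y1]; rewrite -subr_ge0.
apply: (@ge0_of_derivative R (fun t => 1 + 3 / 2 * t ^+ 2 - cosh t) (fun t => 3 * t - sinh t)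
  y) => [//||t|t /andP[t0 ty]].
- by rewrite expr0n /= mulr0 addr0 cosh0 subrr.
- apply: der_eq (derB (derD (der_cst _ _) (der_monomial _ 1 t)) (der_cosh t)) _.
  by field.
- by rewrite subr_ge0 sinh_le3 // t0 (le_trans ty).
Qed.

Lemma sinh_le y : 0 <= y <= 1 -> sinh y <= y + 1 / 2 * y ^+ 3.
Proof.
move=> /andP[y0 y1]; rewrite -subr_ge0.
apply: (@ge0_of_derivative R (fun t => t + 1 / 2 * t ^+ 3 - sinh t) (fun t => 1 + 3 / 2 * t ^+
  2 - cosh t) y) => [//||t|t /andP[t0 ty]].
- by rewrite expr0n /= mulr0 addr0 sinh0 subrr.
- apply: der_eq (derB (derD (der_id _) (der_monomial _ 2 t)) (der_sinh t)) _.
  by field.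
- by rewrite subr_ge0 cosh_le // t0 (le_trans ty).
Qed.

Lemma cosh_le4 y : 0 <= y <= 1 -> cosh y <= 1 + 1 / 2 * y ^+ 2 + 1 / 8 * y ^+ 4.
Proof.
move=> /andP[y0 y1]; rewrite -subr_ge0.
apply: (@ge0_of_derivative R (fun t => 1 + 1 / 2 * t ^+ 2 + 1 / 8 * t ^+ 4 - cosh t) (fun t =>
  t + 1 / 2 * t ^+ 3 - sinh t) y) => [//||t|t /andP[t0 ty]].
- by rewrite !expr0n /= !mulr0 !addr0 cosh0 subrr.
- apply: der_eq (derB (derD (derD (der_cst _ _) (der_monomial _ 1 t)) (der_monomial _ 3 t))
  (der_cosh t)) _.
  by field.
- by rewrite subr_ge0 sinh_le // t0 (le_trans ty).
Qed.

Lemma sin_le_id x : 0 <= x -> sin x <= x.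
Proof.
move=> y0; rewrite -subr_ge0.
apply: (@ge0_of_derivative R (fun t => t - sin t) (fun t => 1 - cos t) x) => [//||t /andP[t0 ty]].
- by rewrite sin0 subrr.
- by rewrite subr_ge0 cos_le1.
Qed.

Lemma cos_ge2 x : 0 <= x -> 1 - 1 / 2 * x ^+ 2 <= cos x.
Proof.
move=> y0; rewrite -subr_ge0.
apply: (@ge0_of_derivative R (fun t => cos t - (1 - 1 / 2 * t ^+ 2)) (fun t => t - sin t) x) =>
  [//||t|t /andP[t0 ty]].
- by rewrite cos0 expr0n /= mulr0 subr0 subrr.
- apply: der_eq (derB (is_derive_cos t) (derB (der_cst _ _) (der_monomial _ 1 t))) _.
  by field.
- by rewrite subr_ge0 sin_le_id.
Qed.

Lemma sin_ge3 x : 0 <= x -> x - 1 / 6 * x ^+ 3 <= sin x.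
Proof.
move=> y0; rewrite -subr_ge0.
apply: (@ge0_of_derivative R (fun t => sin t - (t - 1 / 6 * t ^+ 3)) (fun t => cos t - (1 - 1 /
  2 * t ^+ 2)) x) => [//||t|t /andP[t0 ty]].
- by rewrite sin0 expr0n /= mulr0 subr0 subrr.
- apply: der_eq (derB (is_derive_sin t) (derB (der_id _) (der_monomial _ 2 t))) _.
  by field.
- by rewrite subr_ge0 cos_ge2.
Qed.

Lemma cos_le4 x : 0 <= x -> cos x <= 1 - 1 / 2 * x ^+ 2 + 1 / 24 * x ^+ 4.
Proof.
move=> y0; rewrite -subr_ge0.
apply: (@ge0_of_derivative R (fun t => 1 - 1 / 2 * t ^+ 2 + 1 / 24 * t ^+ 4 - cos t) (fun t =>
  sin t - (t - 1 / 6 * t ^+ 3)) x) => [//||t|t /andP[t0 ty]].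
- by rewrite cos0 !expr0n /= !mulr0 subr0 addr0 subrr.
- apply: der_eq (derB (derD (derB (der_cst _ _) (der_monomial _ 1 t)) (der_monomial _ 3 t))
  (is_derive_cos t)) _.
  by field.
- by rewrite subr_ge0 sin_ge3.
Qed.

Lemma pi_le4 : pi <= 4 :> R.
Proof. by have := @pihalf_lt2 R; lra. Qed.

(** Since 1 - cos f = 2 sin^2 (f/2), this follows from sin u >= u/3 for
    0 <= u <= 2, a range that contains |f|/2 because pi <= 4. *)
Lemma kernel_lower y f : 0 <= y -> `|f| <= pi ->
  (y ^+ 2 + f ^+ 2) / 9 <= 2 * (cosh y - cos f).
Proof.
move=> y0 fpi; have := cosh_ge2 y0.
suff : cos f <= 1 - f ^+ 2 / 18 by nra.
have -> : cos f = 1 - 2 * sin (`|f| / 2) ^+ 2.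
  rewrite sin2cos2 -(cos_norm f) {1}(splitr `|f|) -mulr2n cos_mulr2n.
  by rewrite -mulr_natl; ring.
rewrite -[f ^+ 2]real_normK ?num_real //.
have := @sin_ge3 (`|f| / 2) (divr_ge0 (normr_ge0 _) (ler0n _ _)).
have := pi_le4; have := normr_ge0 f; move: `|f| fpi => g gpi g0 p4 h.
have : g / 6 <= sin (g / 2) by apply: le_trans h; nra.
by move: (sin _) => s hs; nra.
Qed.

Lemma kernel_quadratic y f : 0 <= y <= 1 ->
  `|2 * (cosh y - cos f) - (y ^+ 2 + f ^+ 2)| <= (y ^+ 2 + f ^+ 2) ^+ 2.
Proof.
move=> y01; have /andP[y0 y1] := y01.
have := cosh_le4 y01; have := cosh_ge2 y0.
have := @cos_ge2 `|f| (normr_ge0 f); have := @cos_le4 `|f| (normr_ge0 f).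
have e4 (z : R) : z ^+ 4 = (z ^+ 2) ^+ 2 by rewrite -exprM.
rewrite cos_norm !e4 !real_normK ?num_real //.
move: (cosh y) (cos f) => a b h1 h2 h3 h4.
have := sqr_ge0 y; have := sqr_ge0 f; move: (y ^+ 2) (f ^+ 2) h1 h2 h3 h4 => u v h1 h2 h3 h4 v0
  u0.
have uv := mulr_ge0 u0 v0; have u2 := sqr_ge0 u; have v2 := sqr_ge0 v.
by rewrite ler_norml sqrrD; apply/andP; split; lra.
Qed.

Lemma sin_cubic f : `|sin f - f| <= `|f| ^+ 3.
Proof.
have pos (u : R) : 0 <= u -> `|sin u - u| <= u ^+ 3.
  move=> u0; have := sin_le_id u0; have := sin_ge3 u0; rewrite ler_norml => h1 h2.
  have : 0 <= u ^+ 3 by rewrite exprn_ge0.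
  by move=> h; apply/andP; split; lra.
have [f0|/ltW f0] := leP 0 f; first by rewrite (ger0_norm f0) pos.
have -> : sin f - f = - (sin (- f) - (- f)) by rewrite sinN; ring.
by rewrite (ler0_norm f0) normrN pos // oppr_ge0.
Qed.

Lemma sinh_cubic y : 0 <= y <= 1 -> `|sinh y - y| <= y ^+ 3.
Proof.
move=> y01; have /andP[y0 y1] := y01.
have := sinh_le y01; have := sinh_geid y0; have : 0 <= y ^+ 3 by rewrite exprn_ge0.
by move=> h h1 h2; rewrite ler_norml; apply/andP; split; lra.
Qed.

End Hyperbolic.

(** * The Poisson kernel as a limit of sums over its poles *)

Section PoissonKernel.
Variable R : realType.
Implicit Types (y f : R) (t K : R -> R -> R) (b : R -> R).

(** This is (1 - r^2) / (1 - 2 r cos f + r^2) at r = e^-y. *)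
Definition poissonK y f : R := sinh y / (cosh y - cos f).
(** Twice the real part of 1 / (y + i f): the principal part of the kernel at
    the origin. *)
Definition poissonK_pole y f : R := 2 * y / (y ^+ 2 + f ^+ 2).
(** Minus the derivative of [poissonK] in [f]. *)
Definition dpoissonK y f : R := sinh y * sin f / (cosh y - cos f) ^+ 2.
(** Minus the derivative of [poissonK_pole] in [f]. *)
Definition dpoissonK_pole y f : R := 4 * y * f / (y ^+ 2 + f ^+ 2) ^+ 2.

(** The translates by [2 pi j] with [- J <= j < J], the terms [j] and [- j - 1]
    being taken together. *)
Definition pole_sum t (J : nat) y f : R :=
  \sum_(j < J) (t y (f + 2 * pi * j%:R) + t y (f - 2 * pi * j.+1%:R)).

Lemma cosh_gt1 y : 0 < y -> 1 < cosh y.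
Proof.
move=> y0; apply: lt_le_trans (cosh_ge2 (ltW y0)).
by rewrite ltrDl divr_gt0 // exprn_gt0.
Qed.

Lemma cos_double_half f : cos f = 2 * cos (f / 2) ^+ 2 - 1.
Proof. by rewrite {1}(splitr f) -mulr2n cos_mulr2n mulr_natl. Qed.

Lemma sin_double_half f : sin f = 2 * cos (f / 2) * sin (f / 2).
Proof. by rewrite {1}(splitr f) -mulr2n sin_mulr2n -mulrA mulr_natl. Qed.

Lemma half_kernels_neq0 y f : 0 < y ->
  (cosh (y / 2) - cos (f / 2) != 0) && (cosh (y / 2) + cos (f / 2) != 0).
Proof.
move=> y0; have := @cosh_gt1 (y / 2); rewrite divr_gt0 // => /(_ isT) c1.
have := cos_le1 (f / 2); have := cos_geN1 (f / 2) => h1 h2.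
by apply/andP; split; rewrite gt_eqF //; lra.
Qed.

(** With c = cosh (y/2) and d = cos (f/2), cosh y - cos f = 2 (c - d) (c + d), and
    shifting f/2 by pi changes the sign of d. *)
Lemma poissonK_dup y f : 0 < y ->
  poissonK (y / 2) (f / 2) + poissonK (y / 2) (f / 2 + pi) = 2 * poissonK y f.
Proof.
move=> /half_kernels_neq0 => /(_ f); rewrite /poissonK cosDpi opprK.
rewrite (cosh_half y) (sinh_half y) (cos_double_half f).
move: (cosh _) (cos _) (sinh _) => c d s /andP[h1 h2].
have h3 : 2 * c ^+ 2 - 1 - (2 * d ^+ 2 - 1) != 0.
  have -> : 2 * c ^+ 2 - 1 - (2 * d ^+ 2 - 1) = 2 * ((c - d) * (c + d)) by ring.
  by rewrite !mulf_neq0.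
by field; rewrite h1 h2 h3.
Qed.

Lemma dpoissonK_dup y f : 0 < y ->
  dpoissonK (y / 2) (f / 2) + dpoissonK (y / 2) (f / 2 + pi) = 4 * dpoissonK y f.
Proof.
move=> /half_kernels_neq0 => /(_ f); rewrite /dpoissonK cosDpi sinDpi opprK.
rewrite (cosh_half y) (sinh_half y) (cos_double_half f) (sin_double_half f).
move: (cosh _) (cos _) (sinh _) (sin _) => c d s e /andP[h1 h2].
have h3 : 2 * c ^+ 2 - 1 - (2 * d ^+ 2 - 1) != 0.
  have -> : 2 * c ^+ 2 - 1 - (2 * d ^+ 2 - 1) = 2 * ((c - d) * (c + d)) by ring.
  by rewrite !mulf_neq0.
by field; rewrite h1 h2 h3.
Qed.

(** The translates of f/2 and of f/2 + pi by 2 pi j with -J <= j < J are exactly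
    the halves of the translates of f with -2J <= j < 2J; the choice of the
    window makes this an identity between finite sums. *)
Lemma pole_sum_dup t (h : R) J y f :
  (forall u v, t (u / 2) (v / 2) = h * t u v) ->
  pole_sum t J (y / 2) (f / 2) + pole_sum t J (y / 2) (f / 2 + pi) =
  h * pole_sum t (2 * J) y f.
Proof.
move=> th; have th' v v' : v = v' / 2 -> t (y / 2) v = h * t y v'.
  by move=> ->; exact: th.
rewrite /pole_sum -big_split mulr_sumr /= mul2n -addnn.
rewrite -!(big_mkord xpredT (fun j => h * (t y (f + 2 * pi * j%:R) + t y (f - 2 * pi *
  j.+1%:R)))).
rewrite sum_even_odd big_mkord; apply: eq_bigr => j _.
rewrite (th' _ (f + 2 * pi * j.*2%:R)); last by rewrite -addnn natrD; field.
rewrite (th' _ (f - 2 * pi * j.*2.+2%:R)); last by rewrite -addnn -!natr1 natrD; field.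
rewrite (th' (_ + 2 * pi * _) (f + 2 * pi * j.*2.+1%:R)); last by rewrite -addnn -!natr1 natrD;
  field.
rewrite (th' _ (f - 2 * pi * j.*2.+1%:R)); last by rewrite -addnn -!natr1 natrD; field.
by ring.
Qed.

(** The kernel and its pole sums satisfy the same duplication relation, so the
    error at (y, f) is the sum of two errors at height y/2, divided by [h].
    Iterating, the window of the pole sum grows from 1 to 2^M while the error
    bound is taken at height y / 2^M and multiplied by (2/h)^M. *)
Lemma herglotz_contraction K t (h : R) b :
  0 < h ->
  (forall y f, 0 < y -> K (y / 2) (f / 2) + K (y / 2) (f / 2 + pi) = h * K y f) ->
  (forall u v, t (u / 2) (v / 2) = h * t u v) ->
  (forall y f, 0 < y <= 1 -> 0 <= f <= 2 * pi ->
     `|K y f - pole_sum t 1 y f| <= b y) ->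
  forall M y f, 0 < y <= 2 ^+ M -> 0 <= f <= 2 * pi ->
    `|K y f - pole_sum t (2 ^ M) y f| <= (2 / h) ^+ M * b (y / 2 ^+ M).
Proof.
move=> h0 Kd td Kb; elim=> [|M IH] y f /andP[y0 yM] /andP[f0 fpi].
  by rewrite !expr0 mul1r divr1; apply: Kb; [rewrite y0 /= -[1](expr0 2)|rewrite f0].
have p0 := @pi_gt0 R.
have y2 : 0 < y / 2 <= 2 ^+ M.
  by rewrite divr_gt0 //= ler_pdivrMr // -exprSr.
have h1 : 0 <= f / 2 <= 2 * pi by apply/andP; split; lra.
have h2 : 0 <= f / 2 + pi <= 2 * pi by apply/andP; split; lra.
have := IH _ _ y2 h1; have := IH _ _ y2 h2.
set B := _ * b _ => b1 b2.
have -> : K y f - pole_sum t (2 ^ M.+1) y f =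
   h^-1 * ((K (y / 2) (f / 2 + pi) - pole_sum t (2 ^ M) (y / 2) (f / 2 + pi)) +
    (K (y / 2) (f / 2) - pole_sum t (2 ^ M) (y / 2) (f / 2))).
  transitivity (h^-1 * (h * K y f - h * pole_sum t (2 ^ M.+1) y f)).
    by rewrite -mulrBr mulKf // gt_eqF.
  by rewrite -Kd // expnS -pole_sum_dup //; ring.
rewrite normrM gtr0_norm ?invr_gt0 // mulrC ler_pdivrMr //.
have -> : (2 / h) ^+ M.+1 * b (y / 2 ^+ M.+1) * h = B + B.
  rewrite /B [2 ^+ M.+1]exprS invfM mulrA [(2 / h) ^+ M.+1]exprS; field.
  by rewrite gt_eqF.
by apply: le_trans (ler_normD _ _) _; exact: lerD.
Qed.

Lemma poissonK_pole_half u v : poissonK_pole (u / 2) (v / 2) = 2 * poissonK_pole u v.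
Proof.
rewrite /poissonK_pole; have [e|e] := eqVneq (u ^+ 2 + v ^+ 2) 0.
  have -> : (u / 2) ^+ 2 + (v / 2) ^+ 2 = 0.
    by have -> : (u / 2) ^+ 2 + (v / 2) ^+ 2 = (u ^+ 2 + v ^+ 2) / 4; [field|rewrite e mul0r].
  by rewrite e invr0 !mulr0.
by field.
Qed.

Lemma dpoissonK_pole_half u v : dpoissonK_pole (u / 2) (v / 2) = 4 * dpoissonK_pole u v.
Proof.
rewrite /dpoissonK_pole; have [e|e] := eqVneq (u ^+ 2 + v ^+ 2) 0.
  have -> : (u / 2) ^+ 2 + (v / 2) ^+ 2 = 0.
    by have -> : (u / 2) ^+ 2 + (v / 2) ^+ 2 = (u ^+ 2 + v ^+ 2) / 4; [field|rewrite e mul0r].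
  by rewrite e expr0n invr0 !mulr0.
by field.
Qed.

(** Both numerators and denominators agree to leading order at the origin, with
    relative error of the order of q = y^2 + f^2, while the kernel is of the
    order of y / q. *)
Lemma poissonK_near_pole y f : 0 < y <= 1 -> `|f| <= pi ->
  `|poissonK y f - poissonK_pole y f| <= 36 * y.
Proof.
move=> /andP[y0 y1] fpi; have y01 : 0 <= y <= 1 by rewrite ltW.
have lo := kernel_lower (ltW y0) fpi; have qu := kernel_quadratic f y01.
have sc := sinh_cubic y01; rewrite /poissonK /poissonK_pole.
have q0 : 0 < y ^+ 2 + f ^+ 2 by rewrite ltr_wpDr ?sqr_ge0 // exprn_gt0.
have yq : y ^+ 2 <= y ^+ 2 + f ^+ 2 by rewrite lerDl sqr_ge0.
set q := y ^+ 2 + f ^+ 2 in q0 lo qu yq *.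
move: (cosh y - cos f) (sinh y) lo qu sc => D s lo qu sc.
have D0 : 0 < D by lra.
have -> : s / D - 2 * y / q = 2 * ((s - y) * q - y * (2 * D - q)) / (2 * D * q).
  by field; rewrite !gt_eqF.
rewrite normrM normfV (gtr0_norm (_ : 0 < 2 * D * q)) ?mulr_gt0 //.
rewrite ler_pdivrMr ?mulr_gt0 // normrM ger0_norm //.
have n1 : `|(s - y) * q| <= y * q ^+ 2.
  rewrite normrM (gtr0_norm q0) expr2 mulrA ler_pM2r //.
  by apply: le_trans sc _; rewrite exprS ler_pM2l.
have n2 : `|y * (2 * D - q)| <= y * q ^+ 2 by rewrite normrM gtr0_norm // ler_pM2l.
have n3 := ler_normB ((s - y) * q) (y * (2 * D - q)).
have n4 : q / 9 * q * y <= 2 * D * q * y by rewrite !ler_pM2r.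
by move: n4; rewrite expr2 in n1 n2 *; lra.
Qed.

(** As for [poissonK_near_pole]: the relative error is O(q), and now the kernel is
    O(1 / q). *)
Lemma dpoissonK_near_pole y f : 0 < y <= 1 -> `|f| <= pi ->
  `|dpoissonK y f - dpoissonK_pole y f| <= 4 * (81 * 21).
Proof.
move=> /andP[y0 y1] fpi; have y01 : 0 <= y <= 1 by rewrite ltW.
have lo := kernel_lower (ltW y0) fpi; have qu := kernel_quadratic f y01.
have sc := sinh_cubic y01; have sf := sin_cubic f; have sm := sin_max f.
rewrite /dpoissonK /dpoissonK_pole.
have q0 : 0 < y ^+ 2 + f ^+ 2 by rewrite ltr_wpDr ?sqr_ge0 // exprn_gt0.
have yq : y ^+ 2 <= y ^+ 2 + f ^+ 2 by rewrite lerDl sqr_ge0.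
have fq : `|f| ^+ 2 <= y ^+ 2 + f ^+ 2 by rewrite real_normK ?num_real // lerDr sqr_ge0.
(* 17 = 1 + 4^2, since y <= 1 and |f| <= pi <= 4. *)
have q17 : y ^+ 2 + f ^+ 2 <= 17.
  rewrite -[f ^+ 2]real_normK ?num_real //.
  by have := @pi_le4 R; have := normr_ge0 f; nra.
have yfq : `|y * f| <= y ^+ 2 + f ^+ 2.
  rewrite normrM (gtr0_norm y0) -[f ^+ 2]real_normK ?num_real //.
  by have := normr_ge0 f; nra.
set q := y ^+ 2 + f ^+ 2 in q0 lo qu yq fq q17 yfq *.
have D0 : 0 < cosh y - cos f by lra.
have Qq : 2 * (cosh y - cos f) <= 18 * q.
  by move: qu; rewrite ler_norml => /andP[_]; nra.
move: (cosh y - cos f) D0 lo qu Qq => D D0 lo qu Qq.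
have sp : `|sinh y * sin f - y * f| <= 2 * q ^+ 2.
  have -> : sinh y * sin f - y * f = (sinh y - y) * sin f + y * (sin f - f) by ring.
  apply: le_trans (ler_normD _ _) _; rewrite !normrM (gtr0_norm y0).
  have sf1 : `|sin f| <= `|f|.
    have h (u : R) : 0 <= u -> `|sin u| <= u.
      move=> u0; have [u1|u1] := leP u 1.
        by rewrite ger0_norm ?sin_le_id // sin_ge0_pi // u0 (le_trans u1) // (le_trans _
          (@pi_ge2 R)) // ler1n.
      by apply: le_trans (sin_max _) (ltW u1).
    have [f0|/ltW f0] := leP 0 f; first by rewrite (ger0_norm f0) h.
    by rewrite (ler0_norm f0) -[f in sin f]opprK sinN normrN h // oppr_ge0.
  have a1 : `|sinh y - y| * `|sin f| <= y ^+ 3 * `|f| by rewrite ler_pM.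
  have a2 : y * `|sin f - f| <= y * `|f| ^+ 3 by rewrite ler_pM2l.
  move: a1 a2 yfq; rewrite normrM (gtr0_norm y0) => a1 a2 yfq.
  have b1 : y ^+ 3 * `|f| <= q ^+ 2.
    have -> : y ^+ 3 * `|f| = y ^+ 2 * (y * `|f|) by ring.
    by rewrite expr2 ler_pM ?sqr_ge0 ?mulr_ge0 // ltW.
  have b2 : y * `|f| ^+ 3 <= q ^+ 2.
    have -> : y * `|f| ^+ 3 = `|f| ^+ 2 * (y * `|f|) by ring.
    by rewrite expr2 ler_pM ?sqr_ge0 ?mulr_ge0 // ltW.
  by lra.
move: (sinh y * sin f) sp => s sp.
have -> : s / D ^+ 2 - 4 * y * f / q ^+ 2 =
   4 * ((s - y * f) * q ^+ 2 - (y * f) * ((2 * D - q) * (2 * D + q))) / ((2 * D) ^+ 2 * q ^+ 2).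
  by field; rewrite !gt_eqF.
have P0 : 0 < (2 * D) ^+ 2 * q ^+ 2 by rewrite mulr_gt0 // exprn_gt0 // mulr_gt0.
rewrite normrM normfV (gtr0_norm P0) ler_pdivrMr // normrM ger0_norm // -[4 * _ * _]mulrA
  ler_pM2l //.
have n1 : `|(s - y * f) * q ^+ 2| <= 2 * q ^+ 2 * q ^+ 2.
  by rewrite normrM (gtr0_norm (exprn_gt0 2 q0)) ler_pM2r // exprn_gt0.
have n2 : `|(y * f) * ((2 * D - q) * (2 * D + q))| <= q * (q ^+ 2 * (19 * q)).
  rewrite [in X in X <= _]normrM ler_pM // normrM ler_pM // ger0_norm; lra.
have n3 := ler_normB ((s - y * f) * q ^+ 2) (y * f * ((2 * D - q) * (2 * D + q))).
have n4 : (q / 9) ^+ 2 * q ^+ 2 <= (2 * D) ^+ 2 * q ^+ 2.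
  by rewrite ler_pM2r ?exprn_gt0 // lerXn2r ?nnegrE //; lra.
apply: le_trans n3 _; apply: le_trans (lerD n1 n2) _.
have -> : 2 * q ^+ 2 * q ^+ 2 + q * (q ^+ 2 * (19 * q)) = 81 * 21 * ((q / 9) ^+ 2 * q ^+ 2) by
  field.
by rewrite ler_pM2l.
Qed.

Lemma poissonK_pole_far y f : 0 < y <= 1 -> pi <= `|f| -> `|poissonK_pole y f| <= y.
Proof.
move=> /andP[y0 y1] fpi; rewrite /poissonK_pole.
have p2 := @pi_ge2 R.
have f4 : 4 <= f ^+ 2 by rewrite -[f ^+ 2]real_normK ?num_real //; nra.
have q0 : 0 < y ^+ 2 + f ^+ 2 by rewrite ltr_wpDl ?sqr_ge0 //; lra.
rewrite ger0_norm; last by rewrite divr_ge0 ?mulr_ge0 // ltW.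
by rewrite ler_pdivrMr // [2 * y]mulrC ler_pM2l //; have := sqr_ge0 y; lra.
Qed.

Lemma dpoissonK_pole_far y f : 0 < y <= 1 -> pi <= `|f| -> `|dpoissonK_pole y f| <= 4.
Proof.
move=> /andP[y0 y1] fpi; rewrite /dpoissonK_pole.
have p2 := @pi_ge2 R.
have f4 : 4 <= `|f| ^+ 2 by nra.
have q0 : 0 < y ^+ 2 + f ^+ 2 by rewrite -[f ^+ 2]real_normK ?num_real // ltr_wpDl ?sqr_ge0 //;
  lra.
rewrite normrM normfV [`|_ ^+ 2|]gtr0_norm ?exprn_gt0 // ler_pdivrMr ?exprn_gt0 //.
rewrite -mulrA normrM ger0_norm // ler_pM2l // normrM gtr0_norm //.
rewrite -[f ^+ 2]real_normK ?num_real //.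
have := sqr_ge0 y; have := normr_ge0 f; move: `|f| f4 fpi => g f4 fpi g0 yy.
have h1 : y * g <= g ^+ 2 by rewrite expr2; nra.
have h2 : g ^+ 2 <= y ^+ 2 + g ^+ 2 by lra.
by rewrite [(_ + _) ^+ 2]expr2; nra.
Qed.

(** For 0 <= f <= 2 pi only the poles j = 0 and j = -1 can be close to f; the
    closer one is compared with the kernel and the other one is at distance at
    least pi. *)
Lemma reduced_angle (K t : R -> R -> R) y f (B B' : R) :
  (forall u v, K u (v - 2 * pi) = K u v) ->
  (forall v, `|v| <= pi -> `|K y v - t y v| <= B) ->
  (forall v, pi <= `|v| -> `|t y v| <= B') ->
  0 <= f <= 2 * pi -> `|K y f - pole_sum t 1 y f| <= B + B'.
Proof.
move=> Kp near far /andP[f0 f2]; rewrite /pole_sum big_ord1 mulr0 addr0 mulr1.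
have p0 := @pi_gt0 R; have [fp|fp] := leP f pi.
  rewrite opprD addrA; apply: le_trans (ler_normB _ _) _; apply: lerD.
    by apply: near; rewrite ger0_norm.
  by apply: far; rewrite ler0_norm; lra.
rewrite [t y f + _]addrC opprD addrA; apply: le_trans (ler_normB _ _) _; apply: lerD.
  by rewrite -Kp; apply: near; rewrite ler_norml; apply/andP; split; lra.
by apply: far; rewrite ger0_norm // ltW.
Qed.

Lemma cosB2pi f : cos (f - 2 * pi) = cos f.
Proof. by rewrite -[in RHS](subrK (2 * pi) f) mulr_natl cosD2pi. Qed.

Lemma sinB2pi f : sin (f - 2 * pi) = sin f.
Proof. by rewrite -[in RHS](subrK (2 * pi) f) mulr_natl sinD2pi. Qed.

(** Here h = 2, so nothing is gained from the factor (2/h)^M, and the decay comes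
    from the bound O(y) on the initial error. *)
Lemma poissonK_approx M y f : 0 < y <= 2 ^+ M -> 0 <= f <= 2 * pi ->
  `|poissonK y f - pole_sum poissonK_pole (2 ^ M) y f| <= 37 * y / 2 ^+ M.
Proof.
move=> yM f2.
have := @herglotz_contraction poissonK poissonK_pole 2 (fun u => 37 * u) (ltr0n _ _)
  poissonK_dup poissonK_pole_half _ M y f yM f2.
rewrite divff ?pnatr_eq0 // expr1n mul1r -[37 * y / _]mulrA => H; refine (H _) => u v u1 v2.
have -> : 37 * u = 36 * u + u by ring.
apply: reduced_angle v2 => [w z|w|w]; first by rewrite /poissonK cosB2pi.
  exact: poissonK_near_pole.
exact: poissonK_pole_far.
Qed.

(** Differentiating in [f] doubles the factor of the duplication relation: h = 4,
    so a bounded initial error suffices. *)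
Lemma dpoissonK_approx M y f : 0 < y <= 2 ^+ M -> 0 <= f <= 2 * pi ->
  `|dpoissonK y f - pole_sum dpoissonK_pole (2 ^ M) y f| <= (4 * (81 * 21) + 4) / 2 ^+ M.
Proof.
move=> yM f2.
have := @herglotz_contraction dpoissonK dpoissonK_pole 4 (fun=> 4 * (81 * 21) + 4) (ltr0n _ _)
  dpoissonK_dup dpoissonK_pole_half _ M y f yM f2.
have -> : 2 / 4 = 2^-1 :> R by field.
rewrite exprVn => H; rewrite [_ / 2 ^+ M]mulrC; refine (H _) => u v u1 v2.
apply: reduced_angle v2 => [w z|w|w]; first by rewrite /dpoissonK cosB2pi sinB2pi.
  exact: dpoissonK_near_pole.
exact: dpoissonK_pole_far.
Qed.

End PoissonKernel.

(** * Sums of series *)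

Section Sums.
Variable R : realType.
Implicit Types (u w C : nat -> R) (a b c l : R).

Definition has_sum u l := series u @ \oo --> l.

Lemma has_sum_ext u w l : has_sum u l -> (forall k, u k = w k) -> has_sum w l.
Proof. by move=> + /funext <-. Qed.

Lemma has_sum_uniq u a b : has_sum u a -> has_sum u b -> a = b.
Proof. exact: cvg_unique. Qed.

Lemma has_sumD u w a b : has_sum u a -> has_sum w b ->
  has_sum (fun k => u k + w k) (a + b).
Proof.
rewrite /has_sum => ua wb; have -> : series (fun k => u k + w k) = series u \+ series w.
  by apply/funext => n; rewrite /series /= big_split.
exact: cvgD.
Qed.

Lemma has_sumZ u a c : has_sum u a -> has_sum (fun k => c * u k) (c * a).
Proof.
rewrite /has_sum => ua; have -> : series (fun k => c * u k) = (fun n => c * series u n).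
  by apply/funext => n; rewrite /series /= mulr_sumr.
exact: cvgMl_tmp.
Qed.
Arguments has_sumZ {u a} c _.

Lemma has_sumB u w a b : has_sum u a -> has_sum w b ->
  has_sum (fun k => u k - w k) (a - b).
Proof.
move=> ua wb; have -> : a - b = a + -1 * b by rewrite mulN1r.
by apply: has_sum_ext (has_sumD ua (has_sumZ (-1) wb)) _ => k; rewrite mulN1r.
Qed.

Lemma has_sum_tail u C a c : has_sum u a -> has_sum C c ->
  (forall k, `|u k| <= C k) -> forall K, `|a - series u K| <= c - series C K.
Proof.
move=> ua Cc uC K.
have cl : `|series u n - series u K| @[n --> \oo] --> `|a - series u K|.
  by apply: cvg_norm; apply: cvgB => //; exact: cvg_cst.
have cr : series C n - series C K @[n --> \oo] --> c - series C K.
  by apply: cvgB => //; exact: cvg_cst.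
apply: ler_cvg_to cl cr _; near=> n.
have Kn : (K <= n)%N by near: n; exact: nbhs_infty_ge.
rewrite !sub_series_geq //; apply: le_trans (ler_norm_sum _ _ _) _.
exact: ler_sum.
Unshelve. all: by end_near. Qed.

Lemma has_sum_le u C a c : has_sum u a -> has_sum C c ->
  (forall k, `|u k| <= C k) -> `|a| <= c.
Proof.
move=> ua Cc uC; have := has_sum_tail ua Cc uC 0%N.
by rewrite /series /= !big_nil !subr0.
Qed.

Lemma has_sum_dominated u C c : has_sum C c -> (forall k, `|u k| <= C k) ->
  has_sum u (limn (series u)).
Proof.
move=> Cc uC; apply: normed_cvg.
apply: (@series_le_cvg _ (fun k => `|u k|) C) => // [k|].
  by apply: le_trans (uC k).
by apply/cvg_ex; exists c.
Qed.

(** The partial sums are at most 2 - 1/n by telescoping. *)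
Lemma has_sum_inv_sqr : exists s : R, has_sum (fun k => (k.+1%:R ^+ 2)^-1) s.
Proof.
apply/cvg_ex.
apply: nondecreasing_is_cvgn.
  by apply: nondecreasing_series => k _ _; rewrite invr_ge0 exprn_ge0.
exists 2 => _ [n _ <-].
suff : forall n, series (fun k => (k.+1%:R ^+ 2)^-1) n.+1 <= 2 - n.+1%:R^-1 :> R.
  move=> h; case: n => [|n]; first by rewrite /series /= big_nil.
  by apply: le_trans (h n) _; rewrite gerBl invr_ge0.
move=> {}n; elim: n => [|n IH]; first by rewrite /series /= big_nat1 expr1n invr1 -[2]/(1 + 1)
  addrK.
rewrite seriesSr; apply: le_trans (lerD IH (lexx _)) _.
have n0 : 0 < n.+1%:R :> R by [].
have : (n.+2%:R ^+ 2)^-1 <= n.+1%:R^-1 - n.+2%:R^-1 :> R; last by move=> h;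
  apply: le_trans (lerD (lexx _) h) _; rewrite addrA subrK.
rewrite -[n.+2%:R]natr1; move: (n.+1%:R : R) n0 => x x0.
have x1 : 0 < x + 1 by rewrite addr_gt0.
have -> : x^-1 - (x + 1)^-1 = (x * (x + 1))^-1.
  by field; rewrite !gt_eqF.
by rewrite lef_pV2 ?posrE ?mulr_gt0 ?exprn_gt0 // expr2 ler_pM2r // lerDl.
Qed.

(** Dominated convergence for series: the tails are uniformly small and each
    partial sum converges. *)
Lemma tannery {T : Type} (F : set_system T) {FF : ProperFilter F}
    (f : nat -> T -> R) (l C : nat -> R) (S : T -> R) (L c : R) :
  has_sum C c -> (forall k, f k @ F --> l k) ->
  (forall k t, `|f k t| <= C k) ->
  (forall t, has_sum (fun k => f k t) (S t)) -> has_sum l L ->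
  S @ F --> L.
Proof.
move=> Cc fl fC fS lL.
have lC k : `|l k| <= C k.
  have nl : `|f k t| @[t --> F] --> `|l k| by apply: cvg_norm; exact: fl.
  by apply: (cvgr_to_le nl); apply: nearW => t.
apply/cvgrPdist_le => e e0.
have e4 : 0 < e / 3 by rewrite divr_gt0.
have /cvgrPdist_le /(_ _ e4) [K _ /(_ K (leqnn K)) /= hK] := Cc.
have cK : series (fun k => f k t) K @[t --> F] --> series l K.
  rewrite /series /=; apply: cvg_big => [|k _]; [exact: add_continuous|exact: fl].
move/cvgrPdist_le: cK => /(_ _ e4); apply: filterS => t ht.
have h1 := has_sum_tail (fS t) Cc (fC^~ t) K.
have h2 := has_sum_tail lL Cc lC K.
have h3 := ler_norm (c - series C K).
have -> : L - S t = (L - series l K) + (series l K - series (f^~ t) K) - (S t - series (f^~ t)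
  K) by ring.
apply: le_trans (ler_normB _ _) _.
by have := ler_normD (L - series l K) (series l K - series (f^~ t) K); lra.
Qed.

Lemma der_quadratic (F : R -> R) (x G s : R) :
  (\forall h \near 0, `|F (h + x) - F x - h * G| <= s * h ^+ 2) ->
  is_derive x 1 F G.
Proof.
move=> Fq.
have cv : (fun h => h^-1 *: ((F \o shift x) (h *: 1) - F x)) @ 0^' --> G.
  apply/cvgrPdist_le => e e0.
  have s1 : 0 < `|s| + 1 by rewrite ltr_wpDl.
  have [d /= d0 hd] := Fq.
  near=> h.
  have h0 : h != 0 by near: h; exact: nbhs_dnbhs_neq.
  have hs : `|h| <= e / (`|s| + 1).
    near: h; apply: dnbhs0_le; exact: divr_gt0.
  have hq : `|F (h + x) - F x - h * G| <= s * h ^+ 2.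
    by near: h; apply: nbhs_dnbhs.
  rewrite /= -[_ *: 1]/(h * 1) mulr1 -[_ *: _]/(h^-1 * _).
  have -> : G - h^-1 * (F (h + x) - F x) = - (h^-1 * (F (h + x) - F x - h * G)).
    by field.
  rewrite normrN normrM normfV ler_pdivrMl ?normr_gt0 //.
  apply: le_trans hq _; rewrite -(real_normK (num_real h)) expr2.
  apply: le_trans (_ : `|s| * (`|h| * `|h|) <= _).
    by rewrite ler_wpM2r ?mulr_ge0 // ler_norm.
  rewrite mulrCA ler_wpM2l //.
  apply: le_trans (_ : (`|s| + 1) * `|h| <= _); first by rewrite ler_wpM2r // lerDl.
  by rewrite mulrC -ler_pdivlMr.
have dF : derivable F x 1 by apply/cvg_ex; exists G.
by apply: DeriveDef => //; apply: cvg_lim cv.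
Unshelve. all: by end_near. Qed.

(** The bound on second derivatives makes the sum of the first-order Taylor
    remainders at distance [d] at most [c d^2]. *)
Lemma termwise_derivative (f g h : nat -> R -> R) (C : nat -> R) (c : R)
    (F : R -> R) (x G : R) :
  (forall k (t : R), is_derive t 1 (f k) (g k t)) ->
  (forall k (t : R), is_derive t 1 (g k) (h k t)) ->
  (forall k t, `|h k t| <= C k) -> has_sum C c ->
  (\forall t \near x, has_sum (fun k => f k t) (F t)) ->
  has_sum (fun k => g k x) G -> is_derive x 1 F G.
Proof.
move=> df dg hC Cc fF gG; apply: (@der_quadratic _ _ _ c).
have fx : has_sum (f^~ x) (F x) by exact: nbhs_singleton fF.
have : \forall d \near (0 : R), has_sum (f^~ (d + x)) (F (d + x)).
  have cv : d + x @[d --> (0 : R)] --> x.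
    by rewrite -[X in _ --> X]add0r; apply: cvgD; [exact: cvg_id|exact: cvg_cst].
  exact: cv _ fF.
apply: filterS => d fd.
have qs := has_sumB (has_sumB fd fx) (has_sumZ d gG).
have Cd : has_sum (fun k => C k * d ^+ 2) (c * d ^+ 2).
  by rewrite mulrC; apply: has_sum_ext (has_sumZ _ Cc) _ => k; rewrite mulrC.
apply: has_sum_le qs Cd _ => k.
have gL t : Num.min x (d + x) <= t <= Num.max x (d + x) -> `|g k t - g k x| <= C k * `|d|.
  move=> ht; apply: le_trans (mean_value_bound (dg k) (fun s _ => hC k s)) _.
  apply: ler_wpM2l; first exact: le_trans (hC k 0).
  move: ht; rewrite minEle maxEle.
  have [d0|d0] := leP 0 d.
    by rewrite lerDr d0 => /andP[h1 h2]; rewrite !ger0_norm //; lra.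
  rewrite lerDr (lt_geF d0) => /andP[h1 h2].
  by rewrite !ler0_norm; lra.
have := @mean_value_bound R (fun t => f k t - g k x * t) (fun t => g k t - g k x)
   x (d + x) (C k * `|d|) _ gL.
have -> : C k * d ^+ 2 = C k * `|d| * `|d + x - x|.
  by rewrite addrK -mulrA -expr2 real_normK ?num_real.
move=> H; apply: le_trans (H _).
  by rewrite le_eqVlt; apply/orP; left; apply/eqP; congr `|_|; ring.
move=> t; apply: der_eq (derB (df k t) (derM (der_cst _ _) (der_id t))) _; ring.
Qed.

End Sums.
Arguments has_sumZ {R u a} c _.

(** * Powers of a simple pole *)

Section PolePowers.
Variable R : realType.
Implicit Types (a v t : R) (m j k : nat).

(** Real and imaginary parts of (a - i v)^-m = ((a + i v) / (a^2 + v^2))^m. *)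
Fixpoint pole_power m a v : R * R :=
  if m is m'.+1 then
    let: (c, u) := pole_power m' a v in
    ((a * c - v * u) / (a ^+ 2 + v ^+ 2), (a * u + v * c) / (a ^+ 2 + v ^+ 2))
  else (1, 0).

Definition pole_re m a v : R := (pole_power m a v).1.
Definition pole_im m a v : R := (pole_power m a v).2.

Lemma pole_re0 a v : pole_re 0 a v = 1. Proof. by []. Qed.
Lemma pole_im0 a v : pole_im 0 a v = 0. Proof. by []. Qed.

Lemma pole_reS m a v : pole_re m.+1 a v =
  (a * pole_re m a v - v * pole_im m a v) / (a ^+ 2 + v ^+ 2).
Proof. by rewrite /pole_re /pole_im /=; case: pole_power. Qed.

Lemma pole_imS m a v : pole_im m.+1 a v =
  (a * pole_im m a v + v * pole_re m a v) / (a ^+ 2 + v ^+ 2).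
Proof. by rewrite /pole_re /pole_im /=; case: pole_power. Qed.

Lemma pole_im1 a v : pole_im 1 a v = v / (a ^+ 2 + v ^+ 2).
Proof. by rewrite pole_imS pole_im0 pole_re0 mulr0 add0r mulr1. Qed.

Lemma pole_re1 a v : pole_re 1 a v = a / (a ^+ 2 + v ^+ 2).
Proof. by rewrite pole_reS pole_im0 pole_re0 mulr0 subr0 mulr1. Qed.

Lemma pole_im2 a v : pole_im 2 a v = 2 * a * v / (a ^+ 2 + v ^+ 2) ^+ 2.
Proof. by rewrite pole_imS pole_im1 pole_re1 expr2 invfM; ring. Qed.

Lemma pole_denom_gt0 a v : 0 < a -> 0 < a ^+ 2 + v ^+ 2.
Proof. by move=> a0; rewrite ltr_wpDr ?sqr_ge0 // exprn_gt0. Qed.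

Lemma pole_im_at0 m a : pole_im m a 0 = 0.
Proof. by elim: m => // m IH; rewrite pole_imS IH mulr0 mul0r addr0 mul0r. Qed.

(** The imaginary part of (a - i v) (a - i v)^-(m+1) = (a - i v)^-m. *)
Lemma pole_im_shift m a v : 0 < a ->
  a * pole_im m.+1 a v = pole_im m a v + v * pole_re m.+1 a v.
Proof.
move=> a0; have := pole_denom_gt0 v a0; rewrite pole_imS pole_reS => D0.
by field; rewrite gt_eqF.
Qed.

(** The derivative of (a - i v)^-m in [v] is i m (a - i v)^-(m+1). *)
Lemma der_pole m a v : 0 < a ->
  is_derive v 1 (pole_re m a) (- m%:R * pole_im m.+1 a v) *
  is_derive v 1 (pole_im m a) (m%:R * pole_re m.+1 a v).
Proof.
move=> a0; have D0 := pole_denom_gt0 v a0.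
have dD : is_derive v 1 (fun t => a ^+ 2 + t ^+ 2) (2 * v).
  by apply: der_eq (derD (der_cst _ _) (derXS 1 (der_id v))) _; rewrite expr1; ring.
have dDV := derV (f := fun t => a ^+ 2 + t ^+ 2) (lt0r_neq0 D0) dD.
elim: m => [|m [dc du]].
  by rewrite oppr0 !mul0r; split; exact: der_cst.
have -> : pole_re m.+1 a = fun t => (a * pole_re m a t - t * pole_im m a t) * (a ^+ 2 + t ^+
  2)^-1.
  by apply/funext => t; rewrite pole_reS.
have -> : pole_im m.+1 a = fun t => (a * pole_im m a t + t * pole_re m a t) * (a ^+ 2 + t ^+
  2)^-1.
  by apply/funext => t; rewrite pole_imS.
split.
  apply: der_eq (derM (derB (derM (der_cst a v) dc) (derM (der_id v) du)) dDV) _.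
  by rewrite /= mul0r add0r !(pole_imS, pole_reS) -(natr1 m); field; rewrite gt_eqF.
apply: der_eq (derM (derD (derM (der_cst a v) du) (derM (der_id v) dc)) dDV) _.
by rewrite /= mul0r add0r !(pole_imS, pole_reS) -(natr1 m); field; rewrite gt_eqF.
Qed.

Lemma pole_sqr_le m a v : 0 < a -> pole_re m a v ^+ 2 + pole_im m a v ^+ 2 <= (a ^- m) ^+ 2.
Proof.
move=> a0; have D0 := pole_denom_gt0 v a0; elim: m => [|m IH].
  by rewrite pole_re0 pole_im0 expr0 invr1 expr0n /= addr0.
rewrite pole_reS pole_imS.
set c := pole_re m a v in IH *; set u := pole_im m a v in IH *.
have -> : ((a * c - v * u) / (a ^+ 2 + v ^+ 2)) ^+ 2 + ((a * u + v * c) / (a ^+ 2 + v ^+ 2)) ^+ 2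
  = (c ^+ 2 + u ^+ 2) / (a ^+ 2 + v ^+ 2) by field; rewrite gt_eqF.
rewrite [a ^+ m.+1]exprS invfM [a^-1 * _]mulrC exprMn; apply: ler_pM => //.
- by rewrite addr_ge0 ?sqr_ge0.
- by rewrite invr_ge0 ltW.
by rewrite exprVn lef_pV2 ?posrE ?exprn_gt0 // lerDl sqr_ge0.
Qed.

Lemma pole_re_le m a v : 0 < a -> `|pole_re m a v| <= a ^- m.
Proof.
move=> a0; have am : 0 <= a ^- m by rewrite invr_ge0 exprn_ge0 // ltW.
rewrite -(ler_pXn2r (n := 2)) ?nnegrE // real_normK ?num_real //.
by apply: le_trans (pole_sqr_le m v a0); rewrite lerDl sqr_ge0.
Qed.

Lemma pole_im_le m a v : 0 < a -> `|pole_im m a v| <= a ^- m.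
Proof.
move=> a0; have am : 0 <= a ^- m by rewrite invr_ge0 exprn_ge0 // ltW.
rewrite -(ler_pXn2r (n := 2)) ?nnegrE // real_normK ?num_real //.
by apply: le_trans (pole_sqr_le m v a0); rewrite lerDr sqr_ge0.
Qed.

(** One of the m + 1 factors is bounded by the decay in [v], the others by
    [a^-1]. *)
Lemma pole_im_decay m a v : 0 < a -> 0 < v -> `|pole_im m.+1 a v| <= 2 * a ^- m / v.
Proof.
move=> a0 v0; have D0 := pole_denom_gt0 v a0.
rewrite pole_imS normrM normfV (gtr0_norm D0) ler_pdivrMr //.
have am : 0 <= a ^- m by rewrite invr_ge0 exprn_ge0 // ltW.
have h : `|a * pole_im m a v + v * pole_re m a v| <= (a + v) * a ^- m.
  apply: le_trans (ler_normD _ _) _; rewrite !normrM (gtr0_norm a0) (gtr0_norm v0) mulrDl.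
  by apply: lerD; rewrite ler_pM2l // ?pole_im_le ?pole_re_le.
have e : 2 * a ^- m / v * (a ^+ 2 + v ^+ 2) = 2 * (a ^+ 2 + v ^+ 2) / v * a ^- m by ring.
rewrite e; apply: le_trans h _; apply: ler_wpM2r => //.
by rewrite ler_pdivlMr //; have := sqr_ge0 (a - v); nra.
Qed.

End PolePowers.

(** * Termwise differentiation of pole series *)

Section PoleSeries.
Variable R : realType.
Implicit Types (a v t x y A : R) (m j k p i : nat) (alpha : nat -> R).

(** The poles of tanh and sech on the upper imaginary axis are at [i * node k]. *)
Definition node k : R := (2 * k + 1)%:R * (pi / 2).

Lemma node_ge k : k.+1%:R <= node k.
Proof.
apply: (@le_trans _ _ ((2 * k + 1)%:R * 1)); first by rewrite mulr1 ler_nat; lia.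
by rewrite ler_wpM2l // pihalf_ge1.
Qed.

Lemma node_gt0 k : 0 < node k.
Proof. by apply: lt_le_trans (node_ge k). Qed.

Lemma node_powV_le k m : (2 <= m)%N -> node k ^- m <= (k.+1%:R ^+ 2)^-1.
Proof.
move=> m2; have n1 : 1 <= node k by apply: le_trans (node_ge k); rewrite ler1n.
rewrite lef_pV2 ?posrE ?exprn_gt0 ?node_gt0 //.
apply: (@le_trans _ _ (node k ^+ 2)).
  by rewrite lerXn2r ?nnegrE ?node_ge // ltW // node_gt0.
by rewrite ler_weXn2l.
Qed.

Lemma near_gt0 x : 0 < x -> \forall t \near x, 0 < t.
Proof. by move=> x0; exact: (cvgr_gt x cvg_id). Qed.

(** Two derivatives at a time lead from imaginary parts to imaginary parts.  The
    given derivatives of the sum are identified with the termwise ones by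
    uniqueness of the derivative. *)
Lemma pole_im_series_der2 alpha A j (f f1 f2 : R -> R) :
  (forall k, `|alpha k| <= A) -> (1 <= j)%N ->
  (forall t, 0 < t -> is_derive t 1 f (f1 t)) ->
  (forall t, 0 < t -> is_derive t 1 f1 (f2 t)) ->
  (forall t, 0 < t -> has_sum (fun k => alpha k * pole_im j (node k) t) (f t)) ->
  forall t, 0 < t ->
    has_sum (fun k => alpha k * (- (j * j.+1)%:R * pole_im j.+2 (node k) t)) (f2 t).
Proof.
move=> aA j1 df df1 fs.
have [s hs] := has_sum_inv_sqr R.
have bound i (w : nat -> R -> R) : (1 <= i)%N ->
   (forall k t, `|w k t| <= node k ^- i.+1) ->
   forall c k t, `|alpha k * (c * w k t)| <= (A * `|c|) * (k.+1%:R ^+ 2)^-1.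
  move=> i1 wi c k t; rewrite !normrM mulrA; apply: ler_pM => //.
    by rewrite ler_wpM2r.
  by apply: le_trans (wi k t) _; exact: node_powV_le.
have dre k t i := (der_pole i t (node_gt0 k)).1.
have dim k t i := (der_pole i t (node_gt0 k)).2.
have scal k t (h : R -> R) (d c : R) : is_derive t 1 h d ->
   is_derive t 1 (fun u => alpha k * (c * h u)) (alpha k * (c * d)).
  move=> hd; apply: der_eq (derM (der_cst (alpha k) t) (derM (der_cst c t) hd)) _.
  by rewrite !mul0r !add0r.
have f1s t : 0 < t -> has_sum (fun k => alpha k * (j%:R * pole_re j.+1 (node k) t)) (f1 t).
  move=> t0.
  have gs := has_sum_dominated (has_sumZ _ hs)
     (fun k => bound j (fun k => pole_re j.+1 (node k)) j1
        (fun k t => pole_re_le j.+1 t (node_gt0 k)) j%:R k t).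
  set G := limn _ in gs; suff -> : f1 t = G by [].
  have d0 k (u : R) : is_derive u 1 (fun t => alpha k * pole_im j (node k) t)
      (alpha k * (j%:R * pole_re j.+1 (node k) u)).
    apply: der_eq (derM (der_cst (alpha k) u) (dim k u j)) _.
    by rewrite mul0r add0r.
  have h2 k u : `|alpha k * (j%:R * (- j.+1%:R * pole_im j.+2 (node k) u))| <=
      A * `|- (j * j.+1)%:R| * (k.+1%:R ^+ 2)^-1.
    rewrite (mulrA j%:R) mulrN -natrM.
    by apply: (bound j.+1 (fun k => pole_im j.+2 (node k))) => // k' u';
      apply: pole_im_le (node_gt0 _).
  have fs' : \forall u \near t, has_sum (fun k => alpha k * pole_im j (node k) u) (f u).
    by apply: filterS (near_gt0 t0) => u; exact: fs.
  have d1 k (u : R) := scal k u _ _ j%:R (dre k u j.+1).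
  exact: der_uniq (df t t0) (termwise_derivative d0 d1 h2 (has_sumZ _ hs) fs' gs).
move=> t t0.
have gs := has_sum_dominated (has_sumZ _ hs)
   (fun k => bound j.+1 (fun k => pole_im j.+2 (node k)) isT
      (fun k t => pole_im_le j.+2 t (node_gt0 k)) (- (j * j.+1)%:R) k t).
set G := limn _ in gs; suff -> : f2 t = G by [].
have d1 k (u : R) : is_derive u 1 (fun t => alpha k * (j%:R * pole_re j.+1 (node k) t))
    (alpha k * (- (j * j.+1)%:R * pole_im j.+2 (node k) u)).
  by apply: der_eq (scal k u _ _ j%:R (dre k u j.+1)) _; rewrite (mulrA j%:R) mulrN -natrM.
have d2 k u := scal k u _ _ (- (j * j.+1)%:R) (dim k u j.+2).
have h3 k u : `|alpha k * (- (j * j.+1)%:R * (j.+2%:R * pole_re j.+3 (node k) u))| <=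
    A * `|- (j * j.+1)%:R * j.+2%:R| * (k.+1%:R ^+ 2)^-1.
  rewrite (mulrA (- (j * j.+1)%:R)).
  by apply: (bound j.+2 (fun k => pole_re j.+3 (node k))) => // k' u';
    apply: pole_re_le (node_gt0 _).
have fs' : \forall u \near t, has_sum (fun k => alpha k * (j%:R * pole_re j.+1 (node k) u)) (f1
  u).
  by apply: filterS (near_gt0 t0) => u; exact: f1s.
exact: der_uniq (df1 t t0) (termwise_derivative d1 d2 h3 (has_sumZ _ hs) fs' gs).
Qed.

Lemma pole_im_series_iter alpha A p (F : nat -> R -> R) :
  (forall k, `|alpha k| <= A) ->
  (forall i t, 0 < t -> is_derive t 1 (F i) (F i.+1 t)) ->
  (forall t, 0 < t -> has_sum (fun k => alpha k * pole_im p.+1 (node k) t) (F 0%N t)) ->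
  forall i t, 0 < t ->
    has_sum (fun k => alpha k * ((-1) ^+ i * ((p + 2 * i)`!%:R / p`!%:R) *
      pole_im (p + 2 * i).+1 (node k) t)) (F (2 * i)%N t).
Proof.
move=> aA dF F0; elim=> [|i IH] t t0.
  rewrite muln0 addn0; apply: has_sum_ext (F0 t t0) _ => k.
  by rewrite divff ?expr0 ?mul1r // pnatr_eq0 -lt0n fact_gt0.
set c : R := (-1) ^+ i * ((p + 2 * i)`!%:R / p`!%:R) in IH *.
have IH' u : 0 < u -> has_sum (fun k => (c * alpha k) * pole_im (p + 2 * i).+1 (node k) u) (F
  (2 * i)%N u).
  by move=> u0; apply: has_sum_ext (IH u u0) _ => k; ring.
have cA k : `|c * alpha k| <= `|c| * A by rewrite normrM ler_wpM2l.
have e : (2 * i.+1 = (2 * i).+2)%N by lia.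
rewrite e; apply: has_sum_ext (pole_im_series_der2 cA (isT : (1 <= (p + 2 * i).+1)%N) (dF _)
  (dF _) IH' t0) _ => k.
rewrite !addnS !factS /c exprS !natrM; ring.
Qed.

End PoleSeries.

(** * Integrating a pole series against dv / v *)

Section Antiderivative.
Variable R : realType.
Implicit Types (a v t x y A : R) (m j k p i : nat) (alpha : nat -> R).

(** The antiderivative of [pole_im m a v / v] vanishing at 0.  It comes from
    unfolding [pole_im_shift]: u_(j+1) / v is the sum of u_j / (a v) and of
    c_(j+1) / a, where c_(j+1) is the derivative of u_j / j; the last term
    u_1 / v = 1 / (a^2 + v^2) integrates to the arctangent. *)
Definition pole_prim m a v : R :=
  a ^- m * atan (v / a) + \sum_(1 <= j < m) a ^- (m - j) * (pole_im j a v / j%:R).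

Definition pole_prim_der m a v : R :=
  \sum_(0 <= j < m) a ^- (m - j) * pole_re j.+1 a v.

Definition pole_prim_der2 m a v : R :=
  \sum_(0 <= j < m) a ^- (m - j) * (- j.+1%:R * pole_im j.+2 a v).

Lemma der_sum (I : Type) (r : seq I) (f : I -> R -> R) (d : I -> R) x :
  (forall z : I, is_derive x 1 (f z) (d z)) ->
  is_derive x 1 (fun t => \sum_(z <- r) f z t) (\sum_(z <- r) d z).
Proof.
move=> fd; elim: r => [|z r IH].
  rewrite big_nil; have -> : (fun t => \sum_(z <- [::]) f z t) = (fun=> 0).
    by apply/funext => t; rewrite big_nil.
  exact: der_cst.
rewrite big_cons; have -> : (fun t => \sum_(w <- z :: r) f w t) = (fun t => f z t + \sum_(w <-
  r) f w t).
  by apply/funext => t; rewrite big_cons.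
exact: derD.
Qed.

Lemma der_scale (c : R) (f : R -> R) x d : is_derive x 1 f d ->
  is_derive x 1 (fun t => c * f t) (c * d).
Proof.
by move=> fd; apply: der_eq (derM (der_cst c x) fd) _; rewrite mul0r add0r.
Qed.

Lemma der_pole_prim m a v : 0 < a -> (0 < m)%N ->
  is_derive v 1 (pole_prim m a) (pole_prim_der m a v).
Proof.
move=> a0 m0; have D0 := pole_denom_gt0 v a0.
have dat : is_derive v 1 (fun t => atan (t / a)) (a / (a ^+ 2 + v ^+ 2)).
  apply: der_eq (der_comp (is_derive1_atan _) (derM (der_id v) (der_cst a^-1 v))) _.
  rewrite mulr0 addr0 mul1r.
  have -> : 1 + (v / a) ^+ 2 = (a ^+ 2 + v ^+ 2) / a ^+ 2 by field; rewrite gt_eqF.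
  by field; rewrite !gt_eqF.
have dsum : is_derive v 1 (fun t => \sum_(1 <= j < m) a ^- (m - j) * (pole_im j a t / j%:R))
   (\sum_(1 <= j < m) a ^- (m - j) * (j%:R * pole_re j.+1 a v * j%:R^-1)).
  apply: der_sum => j; apply: der_scale.
  apply: der_eq (derM (der_pole j v a0).2 (der_cst j%:R^-1 v)) _.
  by rewrite mulr0 addr0.
apply: der_eq (derD (der_scale (a ^- m) dat) dsum) _.
rewrite /pole_prim_der [RHS]big_ltn // subn0 pole_re1; congr (_ + _).
apply: eq_big_nat => j /andP[j1 _]; congr (_ * _).
by field; rewrite pnatr_eq0 -lt0n.
Qed.

Lemma der_pole_prim_der m a v : 0 < a ->
  is_derive v 1 (pole_prim_der m a) (pole_prim_der2 m a v).
Proof.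
by move=> a0; apply: der_sum => j; apply: der_scale; exact: (der_pole j.+1 v a0).1.
Qed.

(** By [pole_im_shift] the product telescopes. *)
Lemma mul_pole_prim_der m a v : 0 < a -> v * pole_prim_der m a v = pole_im m a v.
Proof.
move=> a0; rewrite /pole_prim_der mulr_sumr.
rewrite (eq_big_nat _ _ (F2 := fun j => a ^- (m - j.+1) * pole_im j.+1 a v - a ^- (m - j) *
  pole_im j a v)).
  rewrite (telescope_sumr (fun j => a ^- (m - j) * pole_im j a v)) //.
  by rewrite subnn expr0 invr1 mul1r pole_im0 mulr0 subr0.
move=> j /andP[_ jm]; rewrite -(subnSK jm) exprS.
have h := pole_im_shift j v a0.
have -> : pole_im j a v = a * pole_im j.+1 a v - v * pole_re j.+1 a v by rewrite h; ring.
by field; rewrite expf_neq0 !gt_eqF.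
Qed.

Lemma powV_merge a m j i : 0 < a -> (j <= m)%N ->
  a ^- (m - j) * a ^- (j + i) = a ^- (m + i).
Proof. by move=> a0 jm; rewrite -invfM -exprD addnA subnK. Qed.

Lemma atan_bound x : `|atan x| <= 2.
Proof.
have := atan_gtNpi2 x; have := atan_ltpi2 x; have := @pihalf_lt2 R => h1 h2 h3.
by rewrite ler_norml; apply/andP; split; lra.
Qed.

Lemma powV_ge0 a m : 0 < a -> 0 <= a ^- m.
Proof. by move=> a0; rewrite invr_ge0 exprn_ge0 // ltW. Qed.

Lemma pole_prim_le m a v : 0 < a -> `|pole_prim m a v| <= (2 + m%:R) * a ^- m.
Proof.
move=> a0; have am j := powV_ge0 j a0; rewrite mulrDl.
apply: le_trans (ler_normD _ _) _; apply: lerD.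
  by rewrite normrM (ger0_norm (am m)) [_ * `|_|]mulrC; apply: ler_wpM2r => //; exact: atan_bound.
apply: le_trans (ler_norm_sum _ _ _) _.
apply: (@le_trans _ _ (\sum_(1 <= j < m) a ^- m)).
  apply: ler_sum_nat => j /andP[j1 jm].
  rewrite normrM (ger0_norm (am (m - j)%N)) -[m in X in _ <= X]addn0 -(powV_merge 0 a0 (ltnW
    jm)) addn0 ler_wpM2l //.
  rewrite normrM normfV normr_nat ler_pdivrMr ?ltr0n //.
  by apply: le_trans (pole_im_le j v a0) _; rewrite ler_peMr // ler1n.
by rewrite sumr_const_nat -[a ^- m *+ _]mulr_natl ler_wpM2r // ler_nat leq_subr.
Qed.

Lemma pole_prim_der_le m a v : 0 < a -> `|pole_prim_der m a v| <= m%:R * a ^- m.+1.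
Proof.
move=> a0; have am j := powV_ge0 j a0.
apply: le_trans (ler_norm_sum _ _ _) _.
apply: (@le_trans _ _ (\sum_(0 <= j < m) a ^- m.+1)).
  apply: ler_sum_nat => j /andP[_ jm].
  have := powV_merge 1 a0 (ltnW jm); rewrite !addn1 => <-.
  by rewrite normrM (ger0_norm (am (m - j)%N)) ler_wpM2l //; exact: pole_re_le.
by rewrite sumr_const_nat subn0 -[a ^- m.+1 *+ _]mulr_natl.
Qed.

Lemma pole_prim_der2_le m a v : 0 < a -> `|pole_prim_der2 m a v| <= (m * m)%:R * a ^- m.+2.
Proof.
move=> a0; have am j := powV_ge0 j a0.
apply: le_trans (ler_norm_sum _ _ _) _.
apply: (@le_trans _ _ (\sum_(0 <= j < m) m%:R * a ^- m.+2)).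
  apply: ler_sum_nat => j /andP[_ jm].
  have := powV_merge 2 a0 (ltnW jm); rewrite !addn2 => <-.
  rewrite normrM (ger0_norm (am (m - j)%N)) mulrCA ler_wpM2l //.
  by rewrite normrM normrN normr_nat ler_pM // ?ler_nat //; exact: pole_im_le.
by rewrite sumr_const_nat subn0 natrM -[m%:R * a ^- m.+2 *+ _]mulr_natl mulrA.
Qed.

Lemma pole_prim0 m a : pole_prim m a 0 = 0.
Proof.
rewrite /pole_prim mul0r atan0 mulr0 add0r big1 // => j _.
by rewrite pole_im_at0 mul0r mulr0.
Qed.

Lemma cvgy_pole_im m a : 0 < a -> pole_im m.+1 a v @[v --> +oo] --> 0.
Proof.
move=> a0; apply/cvgr0Pnorm_le => e e0; near=> v.
have v0 : 0 < v by near: v; exact: nbhs_pinfty_gt.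
have ve : 2 * a ^- m / e <= v by near: v; apply: nbhs_pinfty_ge; exact: num_real.
apply: le_trans (pole_im_decay m a0 v0) _; rewrite ler_pdivrMr // [e * v]mulrC.
by rewrite -(ler_pdivrMr _ _ e0).
Unshelve. all: by end_near. Qed.

Lemma cvgy_pole_prim m a : 0 < a -> pole_prim m a v @[v --> +oo] --> a ^- m * (pi / 2).
Proof.
move=> a0; rewrite -[X in _ --> X]addr0; apply: cvgD.
  apply: cvgMl_tmp.
  have va : (a^-1 * v) @[v --> +oo] --> +oo.
    by apply: gt0_cvgMry; [rewrite invr_gt0|exact: cvg_id].
  have -> : (fun v => atan (v / a)) = @atan R \o (fun v => a^-1 * v).
    by apply/funext => v; rewrite /= mulrC.
  exact: cvg_comp va (@cvgy_atan R).
rewrite -[X in _ --> X](@big1 R 0 +%R nat (index_iota 1 m) xpredT (fun=> 0)) //.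
apply: cvg_big => [|j _]; first exact: add_continuous.
rewrite -[X in _ --> X](mulr0 (a ^- (m - j))); apply: cvgMl_tmp.
rewrite -[X in _ --> X](mul0r j%:R^-1); apply: cvgMr_tmp.
by case: j => [|j]; [exact: cvg_cst|exact: cvgy_pole_im].
Qed.

(** The antiderivatives of the terms and their first two derivatives are
    dominated by multiples of [node k ^- m], so their series can be
    differentiated and passed to the limit termwise.  At infinity only the
    arctangents survive, each contributing [pi / 2]. *)
Lemma pole_series_antiderivative alpha A m L :
  (2 <= m)%N -> (forall k, `|alpha k| <= A) ->
  has_sum (fun k => alpha k * node R k ^- m) L ->
  exists Psi : R -> R,
  [/\ forall v s, 0 < v -> has_sum (fun k => alpha k * pole_im m (node R k) v) s ->
        is_derive v 1 Psi (s / v),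
      Psi v @[v --> 0] --> 0 & Psi v @[v --> +oo] --> L * (pi / 2)].
Proof.
move=> m2 aA aL; have [s hs] := has_sum_inv_sqr R.
have m0 : (0 < m)%N by exact: ltnW.
have A0 : 0 <= A by apply: le_trans (aA 0%N).
have bound (c : R) (i : nat) (w : nat -> R -> R) : 0 <= c -> (2 <= i)%N ->
   (forall k t, `|w k t| <= c * node R k ^- i) ->
   forall k t, `|alpha k * w k t| <= (A * c) * (k.+1%:R ^+ 2)^-1.
  move=> c0 i2 wi k t; rewrite normrM -mulrA; apply: ler_pM => //.
  by apply: le_trans (wi k t) _; rewrite ler_wpM2l // node_powV_le.
have pb := bound (2 + m%:R) m (fun k => pole_prim m (node R k)) (addr_ge0 (ler0n _ _) (ler0n _
  _)) m2
  (fun k t => pole_prim_le m t (node_gt0 R k)).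
have db := bound m%:R m.+1 (fun k => pole_prim_der m (node R k)) (ler0n _ _) (leqW m2)
  (fun k t => pole_prim_der_le m t (node_gt0 R k)).
have d2b := bound (m * m)%:R m.+2 (fun k => pole_prim_der2 m (node R k)) (ler0n _ _) (leqW
  (leqW m2))
  (fun k t => pole_prim_der2_le m t (node_gt0 R k)).
pose Psi v := limn (series (fun k => alpha k * pole_prim m (node R k) v)).
have Psis v : has_sum (fun k => alpha k * pole_prim m (node R k) v) (Psi v).
  exact: (has_sum_dominated (has_sumZ _ hs) (fun k => pb k v)).
have dPsi v G : has_sum (fun k => alpha k * pole_prim_der m (node R k) v) G ->
    is_derive v 1 Psi G.
  move=> hG.
  have d1 k (t : R) : is_derive t 1 (fun t => alpha k * pole_prim m (node R k) t)
     (alpha k * pole_prim_der m (node R k) t).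
    by apply: der_scale; apply: der_pole_prim => //; exact: node_gt0.
  have d2 k (t : R) : is_derive t 1 (fun t => alpha k * pole_prim_der m (node R k) t)
     (alpha k * pole_prim_der2 m (node R k) t).
    by apply: der_scale; apply: der_pole_prim_der => //; exact: node_gt0.
  have Psin : \forall u \near v, has_sum (fun k => alpha k * pole_prim m (node R k) u) (Psi u).
    by near=> u; exact: (Psis u).
  exact: (termwise_derivative d1 d2 d2b (has_sumZ _ hs) Psin hG).
exists Psi; split.
- move=> v t v0 ht; apply: dPsi; rewrite mulrC.
  apply: has_sum_ext (has_sumZ v^-1 ht) _ => k.
  rewrite -(mul_pole_prim_der m v (node_gt0 R k)); field.
  by rewrite gt_eqF.
- have h0 := has_sum_dominated (has_sumZ _ hs) (fun k => db k 0).
  have /der_cont := dPsi 0 _ h0.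
  have P0 : Psi 0 = 0.
    apply: has_sum_uniq (Psis 0) _.
    have := has_sumZ 0 (Psis 0); rewrite mul0r => h.
    by apply: has_sum_ext h _ => k; rewrite pole_prim0 mulr0 mul0r.
  by rewrite /prop_for /continuous_at P0.
- have cl k : alpha k * pole_prim m (node R k) v @[v --> +oo] --> alpha k * (node R k ^- m *
  (pi / 2)).
    by apply: cvgMl_tmp; exact: cvgy_pole_prim (node_gt0 R k).
  have Ls : has_sum (fun k => alpha k * (node R k ^- m * (pi / 2))) (L * (pi / 2)).
    by rewrite [L * _]mulrC; apply: has_sum_ext (has_sumZ (pi / 2) aL) _ => k; ring.
  exact: (tannery (has_sumZ _ hs) cl pb Psis Ls).
Unshelve. all: by end_near. Qed.

End Antiderivative.

(** * Partial fractions of tanh and of the derivative of sech *)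

Section PartialFractions.
Variable R : realType.
Implicit Types (y f x : R).

(** At f = pi/2 the translates of f are the nodes with alternating signs:
    pi/2 + 2 pi j is the node of index 2j, and pi/2 - 2 pi (j + 1) is minus the
    node of index 2j + 1. *)
Lemma pole_sum_nodes (t : R -> R -> R) (J : nat) y (e : R) (m : nat) :
  (forall v, t y v = 2 * pole_im m v y) ->
  (forall v, pole_im m (- v) y = e * pole_im m v y) -> e ^+ 2 = 1 ->
  pole_sum t J y (pi / 2) = series (fun k => 2 * (e ^+ k * pole_im m (node R k) y)) (2 * J)%N.
Proof.
move=> te pe e2; rewrite /pole_sum /series /= mul2n -addnn.
rewrite sum_even_odd big_mkord; apply: eq_bigr => j _; rewrite !te.
have n1 : pi / 2 + 2 * pi * j%:R = node R j.*2.
  by rewrite /node natrD natrM -mul2n natrM; field.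
have n2 : pi / 2 - 2 * pi * j.+1%:R = - node R j.*2.+1.
  by rewrite /node natrD natrM -natr1 -[j.*2.+1%:R]natr1 -mul2n natrM; field.
rewrite n1 n2 pe exprS -mul2n exprM e2 expr1n; ring.
Qed.

(** The contraction controls only the partial sums with 2 * 2^M terms; this
    determines the sum once convergence is known. *)
Lemma series_pow2_lim (u : nat -> R) (l s C : R) (M0 : nat) :
  has_sum u s ->
  (forall M, (M0 <= M)%N -> `|l - series u (2 * 2 ^ M)%N| <= C / 2 ^+ M) -> has_sum u l.
Proof.
move=> us h; suff -> : l = s by [].
have sub : series u (2 * 2 ^ M)%N @[M --> \oo] --> s.
  apply: (cvg_comp (fun M => (2 * 2 ^ M)%N) (series u) _ us).
  apply/cvgnyPge => A; near=> M.
  apply: (@leq_trans M); first by near: M; exact: nbhs_infty_ge.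
  by apply: leq_trans (ltnW (ltn_expl M (isT : 1 < 2)%N)) _; rewrite leq_pmull.
apply: cvg_unique sub => //.
apply/cvgrPdist_le => e e0.
have g : C * 2^-1 ^+ M @[M --> \oo] --> (0 : R).
  rewrite -(mulr0 C); apply: cvgMl_tmp; apply: cvg_expr.
  by rewrite gtr0_norm ?invr_gt0 // invf_lt1 // ltr1n.
move/cvgr0Pnorm_le: g => /(_ _ e0) g; near=> M.
apply: le_trans (h M _) _; first by near: M; exact: nbhs_infty_ge.
apply: le_trans (ler_norm _) _; rewrite -exprVn; near: M; exact: g.
Unshelve. all: by end_near. Qed.

Lemma exists_pow2 y : exists M0, forall M, (M0 <= M)%N -> y <= 2 ^+ M.
Proof.
exists (Num.truncn `|y|).+1 => M hM.
apply: le_trans (ler_norm y) _; apply: ltW; apply: lt_le_trans (truncnS_gt `|y|) _.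
rewrite -natrX ler_nat; apply: leq_trans hM _; exact/ltnW/ltn_expl.
Qed.

(** At f = pi/2 the kernel [poissonK] is tanh. *)
Lemma tanh_partial_fractions y : 0 < y ->
  has_sum (fun k => 2 * pole_im 1 (node R k) y) (sinh y / cosh y).
Proof.
move=> y0; have [M0 hM] := exists_pow2 y.
have [s hs] := has_sum_inv_sqr R.
have conv := has_sum_dominated (u := fun k => 2 * pole_im 1 (node R k) y) (has_sumZ (2 * y) hs).
apply: (series_pow2_lim (conv _) (C := 37 * y) (M0 := M0)) => [k|M MM].
  rewrite normrM ger0_norm // -mulrA ler_pM2l // pole_im1.
  rewrite normrM normfV (gtr0_norm y0) ler_pM2l // gtr0_norm ?pole_denom_gt0 ?node_gt0 //.
  apply: (@le_trans _ _ (node R k ^- 2)); last exact: node_powV_le.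
  rewrite lef_pV2 ?posrE ?exprn_gt0 ?node_gt0 ?pole_denom_gt0 ?node_gt0 //.
  by rewrite lerDl sqr_ge0.
have p0 := @pi_gt0 R.
have pb : 0 <= (pi : R) / 2 <= 2 * pi by apply/andP; split; lra.
have yM : 0 < y <= 2 ^+ M by rewrite y0 hM.
have := poissonK_approx yM pb.
rewrite (@pole_sum_nodes _ _ _ 1 1).
- rewrite /poissonK cos_pihalf subr0.
  have -> // : (fun k => 2 * (1 ^+ k * pole_im 1 (node R k) y)) = (fun k => 2 * pole_im 1 (node
    R k) y).
  by apply/funext => k; rewrite expr1n mul1r.
- by move=> v; rewrite pole_im1 /poissonK_pole [v ^+ 2 + _]addrC mulrA.
- by move=> v; rewrite !pole_im1 sqrrN mul1r.
- by rewrite expr1n.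
Qed.

(** At f = pi/2 the kernel [dpoissonK] is minus the derivative of sech. *)
Lemma sech_der_partial_fractions y : 0 < y ->
  has_sum (fun k => 2 * ((-1) ^+ k * pole_im 2 (node R k) y)) (sinh y / cosh y ^+ 2).
Proof.
move=> y0; have [M0 hM] := exists_pow2 y.
have [s hs] := has_sum_inv_sqr R.
have conv := has_sum_dominated (u := fun k => 2 * ((-1) ^+ k * pole_im 2 (node R k) y))
  (has_sumZ 2 hs).
apply: (series_pow2_lim (conv _) (C := 4 * (81 * 21) + 4) (M0 := M0)) => [k|M MM].
  rewrite normrM ger0_norm // ler_pM2l // normrM normrX normrN1 expr1n mul1r.
  apply: le_trans (pole_im_le 2 y (node_gt0 R k)) _; exact: node_powV_le.
have p0 := @pi_gt0 R.
have pb : 0 <= (pi : R) / 2 <= 2 * pi by apply/andP; split; lra.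
have yM : 0 < y <= 2 ^+ M by rewrite y0 hM.
have := dpoissonK_approx yM pb.
rewrite (@pole_sum_nodes _ _ _ (-1) 2).
- by rewrite /dpoissonK cos_pihalf sin_pihalf subr0 mulr1.
- by move=> v; rewrite pole_im2 /dpoissonK_pole [v ^+ 2 + _]addrC; ring.
- by move=> v; rewrite !pole_im2 sqrrN; ring.
- by rewrite sqrrN expr1n.
Qed.

End PartialFractions.

(** * Higher derivatives of tanh and sech *)

Section DerivativePolynomials.
Variable R : realType.
Implicit Types (t x y : R) (m n i k : nat).

(** The polynomial giving the [m]-th derivative of tanh in terms of tanh. *)
Fixpoint tanh_poly m : {poly R} :=
  if m is m'.+1 then (1 - 'X ^+ 2) * (tanh_poly m')^`() else 'X.

(** The [m]-th derivative of sech is sech times this polynomial in tanh. *)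
Fixpoint sech_poly m : {poly R} :=
  if m is m'.+1 then (1 - 'X ^+ 2) * (sech_poly m')^`() - 'X * sech_poly m' else 1.

Lemma horner_1subX2 x : (1 - 'X ^+ 2 : {poly R}).[x] = 1 - x ^+ 2.
Proof. by rewrite !hornerE. Qed.

Lemma horner_1DX x : (1 + 'X : {poly R}).[x] = 1 + x.
Proof. by rewrite !hornerE. Qed.

Lemma horner_1subX x : (1 - 'X : {poly R}).[x] = 1 - x.
Proof. by rewrite !hornerE. Qed.

Definition tanh t : R := sinh t / cosh t.

Lemma der_tanh t : is_derive t 1 tanh (1 - tanh t ^+ 2).
Proof.
have c0 := lt0r_neq0 (cosh_gt0 t).
apply: der_eq (derM (der_sinh t) (derV c0 (der_cosh t))) _.
by rewrite /tanh; field.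
Qed.

Lemma der_tanh_poly m t :
  is_derive t 1 (fun s => (tanh_poly m).[tanh s]) (tanh_poly m.+1).[tanh t].
Proof.
apply: der_eq (der_comp (is_derive_poly (tanh_poly m) _) (der_tanh t)) _.
by rewrite /= hornerM horner_1subX2 mulrC.
Qed.

Lemma der_sech_poly m t :
  is_derive t 1 (fun s => (cosh s)^-1 * (sech_poly m).[tanh s])
    ((cosh t)^-1 * (sech_poly m.+1).[tanh t]).
Proof.
have c0 := lt0r_neq0 (cosh_gt0 t).
apply: der_eq (derM (derV c0 (der_cosh t))
  (der_comp (is_derive_poly (sech_poly m) _) (der_tanh t))) _.
rewrite /= hornerD hornerN !hornerM horner_1subX2 hornerX /tanh.
move: (sech_poly m).[_] (sech_poly m)^`().[_] => u w; by field.
Qed.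

Definition eulerianA_poly m : {poly R} := eulerian_poly (fun k => (eulerianA m k)%:R) m.
Definition eulerianB_poly m : {poly R} := eulerian_poly (fun k => (eulerianB m k)%:~R) m.

Lemma eulerianA_poly_rec m : eulerianA_poly m.+1 =
  - ((1 - 'X ^+ 2) * (eulerianA_poly m)^`()) + (1 + 'X) * eulerianA_poly m.
Proof.
rewrite /eulerianA_poly (@eulerian_poly_rec _ 1 1 0 (fun k => (eulerianA m k)%:R)) //.
- by rewrite scale1r scale1r scale0r subr0.
- by case: m => [|m]; rewrite ?eulerianA0 // eulerianA_large.
- by rewrite eulerianA_rec mul1n addn0 mul1r.
move=> k km; rewrite eulerianA_rec natrD !natrM !mul1r addr0.
by rewrite -[k.+2%:R]natr1.
Qed.

Lemma eulerianB_poly_rec m : eulerianB_poly m.+1 =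
  - (2 *: ((1 - 'X ^+ 2) * (eulerianB_poly m)^`())) + 2 *: 'X * eulerianB_poly m.
Proof.
rewrite /eulerianB_poly (@eulerian_poly_rec _ 2 1 1 (fun k => (eulerianB m k)%:~R)) //.
- congr (_ + _ * _); rewrite !scale1r scaler_nat; ring.
- by rewrite eulerianB_large.
- by rewrite eulerianB_rec0 mul1r.
have odd_cast (c : nat) : (2 * c%:Z + 1)%:~R = 2 * c%:R + 1 :> R.
  have -> : 2 * c%:Z + 1 = (2 * c + 1)%N%:Z by lia.
  by rewrite -pmulrn natrD natrM.
by move=> k km; rewrite eulerianB_recS subzn // rmorphD !rmorphM /= !odd_cast.
Qed.

(** Differentiating the factor 1 - X produces the term (1 + X) P of
    [eulerianA_poly_rec]. *)
Lemma tanh_polyE m : tanh_poly m.+1 = (-1) ^+ m *: ((1 - 'X) * eulerianA_poly m.+1).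
Proof.
elim: m => [|m IH].
  have e0 : eulerianA_poly 0 = 1.
    by rewrite /eulerianA_poly /eulerian_poly big_ord1 eulerianA0 /= !expr0 !mulr1 scale1r.
  by rewrite eulerianA_poly_rec e0 /= derivX -polyC1 derivC expr0 scale1r; ring.
have -> : tanh_poly m.+2 = (1 - 'X ^+ 2) * (tanh_poly m.+1)^`() by [].
rewrite IH (eulerianA_poly_rec m.+1) derivZ derivM derivB derivX -polyC1 derivC.
by rewrite -!mul_polyC !(polyC_exp, polyCN, polyC1) [(-1) ^+ m.+1]exprS; ring.
Qed.

Lemma sech_polyE m : sech_poly m = (- 2^-1) ^+ m *: eulerianB_poly m.
Proof.
elim: m => [|m IH].
  by rewrite /eulerianB_poly /eulerian_poly big_ord1 eulerianB0 /= !expr0 !mulr1 scale1r scale1r.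
have -> : sech_poly m.+1 = (1 - 'X ^+ 2) * (sech_poly m)^`() - 'X * sech_poly m by [].
rewrite IH eulerianB_poly_rec derivZ [(- 2^-1) ^+ m.+1]exprS.
have h : (-2^-1 * (-2^-1) ^+ m) *: (2 *: ((1 - 'X ^+ 2) * (eulerianB_poly m)^`())) = - ((-2^-1)
  ^+ m *: ((1 - 'X ^+ 2) * (eulerianB_poly m)^`())).
  by rewrite scalerA -scaleNr; congr (_ *: _); field.
have h2 : (-2^-1 * (-2^-1) ^+ m) *: (2 *: 'X * eulerianB_poly m) = - ((-2^-1) ^+ m *: ('X *
  eulerianB_poly m)).
  by rewrite -scalerAl scalerA -scaleNr; congr (_ *: _); field.
by rewrite scalerDr scalerN h h2 opprK -!scalerAr.
Qed.

(** Pair the symmetric terms and expand each pair in powers of x. *)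
Lemma alternating_sum_expansion (w : nat -> int) n x :
  (forall k, (k < 2 * n)%N -> w (2 * n - 1 - k)%N = w k) ->
  \sum_(k < 2 * n) (-1) ^+ k * (w k)%:~R * ((1 + x) ^+ (2 * n - 1 - k) * (1 - x) ^+ k) =
  2 * x * \sum_(0 <= t < n) (\sum_(0 <= k < n) w k * (-1) ^+ k *
    \sum_(0 <= i < k.+1) (-1) ^+ i * 'C(k, i)%:Z *
      (binz (2 * n - 2 * k - 1) ((2 * t)%N%:Z - (2 * i)%N%:Z + 1))%:Z)%:~R * x ^+ (2 * t).
Proof.
move=> ws; rewrite (@sym_alternating_sum _ (fun k => (w k)%:~R)); last by move=> k kn; rewrite ws.
transitivity (\sum_(0 <= k < n) 2 * x * ((-1) ^+ k * (w k)%:~R *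
   \sum_(0 <= t < n) (\sum_(0 <= i < k.+1) (-1) ^+ i * 'C(k, i)%:Z *
      (binz (2 * n - 2 * k - 1) ((2 * t)%N%:Z - (2 * i)%N%:Z + 1))%:Z)%:~R * x ^+ (2 * t))).
  rewrite big_mkord; apply: eq_bigr => k _; have := ltn_ord k => kn.
  rewrite -binz_expansion //.
  have e : (2 * n - 2 * k - 1 = 2 * (n - k).-1 + 1)%N by lia.
  rewrite [in X in X = _]e odd_binomial_diff -e prednK ?subn_gt0 //.
  have -> : (1 + x) * (1 - x) = 1 - x ^+ 2 by ring.
  by ring.
rewrite -mulr_sumr; congr (_ * _).
rewrite (eq_bigr _ (fun k _ => mulr_sumr _ _ _ _)) exchange_big /=.
apply: eq_bigr => t _; rewrite rmorph_sum mulr_suml; apply: eq_bigr => k _.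
by rewrite [in RHS]rmorphM rmorphM rmorphXn rmorphN1 /=; ring.
Qed.

Lemma tanh_poly_calC n x : (1 <= n)%N ->
  (tanh_poly (2 * n)).[x] =
  - (2 * x * (1 - x ^+ 2) * \sum_(0 <= t < n) (calC_A n t)%:~R * x ^+ (2 * t)).
Proof.
move=> n1; have e : (2 * n = (2 * n).-1.+1)%N by lia.
rewrite [in LHS]e tanh_polyE -e hornerZ hornerM.
have -> : (-1) ^+ (2 * n).-1 = -1 :> R.
  by rewrite -signr_odd (_ : odd _ = true) ?expr1 //; lia.
rewrite /eulerianA_poly /eulerian_poly big_ord_recr /= eulerianA_large //; last by lia.
rewrite mulr0 scale0r addr0 horner_sum.
have -> : \sum_(i < 2 * n) (((-1) ^+ i * (eulerianA (2 * n) i)%:R) *: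
   ((1 + 'X) ^+ (2 * n - i) * (1 - 'X) ^+ i)).[x] =
  (1 + x) * \sum_(k < 2 * n) (-1) ^+ k * ((eulerianA (2 * n) k)%:Z)%:~R * ((1 + x) ^+ (2 * n -
    1 - k) * (1 - x) ^+ k).
  rewrite mulr_sumr; apply: eq_bigr => k _; have := ltn_ord k => kn.
  rewrite hornerZ hornerM !horner_exp horner_1DX horner_1subX.
  have -> : (2 * n - k = (2 * n - 1 - k).+1)%N by lia.
  by rewrite exprS; ring.
rewrite (@alternating_sum_expansion (fun k => (eulerianA (2 * n) k)%:Z)).
  by rewrite horner_1subX /calC_A; ring.
by move=> k kn; rewrite -[in RHS]eulerianA_sym // subn1.
Qed.

Lemma sech_poly_calC n x : (1 <= n)%N ->
  (sech_poly (2 * n - 1)).[x] =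
  - (2 ^- (2 * n - 1) * (2 * x) * \sum_(0 <= t < n) (calC_B n t)%:~R * x ^+ (2 * t)).
Proof.
move=> n1; have e : ((2 * n - 1).+1 = 2 * n)%N by lia.
rewrite sech_polyE hornerZ exprNn.
have -> : (-1) ^+ (2 * n - 1) = -1 :> R.
  by rewrite -signr_odd (_ : odd _ = true) ?expr1 //; lia.
rewrite /eulerianB_poly /eulerian_poly horner_sum e.
have -> : \sum_(i < 2 * n) (((-1) ^+ i * (eulerianB (2 * n - 1) i)%:~R) *:
   ((1 + 'X) ^+ (2 * n - 1 - i) * (1 - 'X) ^+ i)).[x] =
  \sum_(k < 2 * n) (-1) ^+ k * (eulerianB (2 * n - 1) k)%:~R * ((1 + x) ^+ (2 * n - 1 - k) * (1
    - x) ^+ k).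
  by apply: eq_bigr => k _; rewrite hornerZ hornerM !horner_exp horner_1DX horner_1subX.
rewrite (@alternating_sum_expansion (eulerianB (2 * n - 1))).
  by rewrite exprVn /calC_B; ring.
by move=> k kn; rewrite eulerianB_sym //; lia.
Qed.

End DerivativePolynomials.

(** * Improper integrals over the unit interval *)

Section UnitIntervalIntegral.
Variable R : realType.
Notation mu := (@lebesgue_measure R).
Implicit Types (f g F G : R -> R) (a b A B : R).

(* Denominators of at least 3 make [lo n < hi n] for every [n]. *)
Let lo (n : nat) : R := n.+3%:R^-1.
Let hi (n : nat) : R := 1 - n.+3%:R^-1.

Let lo_gt0 n : 0 < lo n. Proof. by rewrite invr_gt0. Qed.

Let lo_lt n : lo n < 2^-1.
Proof. by rewrite ltf_pV2 ?posrE // ltr_nat. Qed.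

Let lo_hi n : lo n < hi n.
Proof. by rewrite /hi -/(lo n); have := lo_lt n; lra. Qed.

Let lo_cvg : lo n @[n --> \oo] --> 0.
Proof.
have h : [sequence (n.+1%:R^-1 : R)]_n @ \oo --> 0 := @cvg_harmonic R.
by rewrite -(cvg_shiftn 2) in h; move: h; under eq_fun do rewrite addn2.
Qed.

Let exhaust : \bigcup_n `[lo n, hi n]%classic = `]0%R, 1%R[%classic :> set R.
Proof.
apply/seteqP; split => x /=.
  move=> [n _ /=]; rewrite !in_itv /= => /andP[h1 h2].
  by rewrite (lt_le_trans (lo_gt0 n) h1) (le_lt_trans h2) // /hi gtrBl invr_gt0.
rewrite in_itv /= => /andP[x0 x1].
have m0 : 0 < Num.min x (1 - x) by rewrite lt_min x0 subr_gt0.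
have /cvgr0Pnorm_le /(_ _ m0) [N _ hN] := lo_cvg.
exists N => //=; have := hN N (leqnn N); rewrite ger0_norm ?(ltW (lo_gt0 N)) // le_min =>
  /andP[h1 h2].
by rewrite in_itv /= h1 /= /hi -/(lo N); lra.
Qed.

(** Exhaust the open interval by compact ones, where the fundamental theorem of
    calculus applies, and use monotone convergence. *)
Lemma ge0_FTC_unit_oo f F A B :
  (forall x : R, 0 < x < 1 -> is_derive x 1 F (f x)) ->
  (forall x : R, 0 < x < 1 -> {for x, continuous f}) ->
  (forall x : R, 0 < x < 1 -> 0 <= f x) ->
  F x @[x --> 0^'+] --> A -> F x @[x --> 1^'-] --> B ->
  (\int[mu]_(x in `]0%R, 1%R[) (f x)%:E = (B - A)%:E)%E.
Proof.
move=> dF cf f0 FA FB.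
have itv01 n x : lo n <= x <= hi n -> 0 < x < 1.
  move=> /andP[h1 h2]; rewrite (lt_le_trans (lo_gt0 n) h1) /=.
  by apply: le_lt_trans h2 _; rewrite /hi gtrBl invr_gt0.
have cfn n : {within `[lo n, hi n], continuous f}.
  by apply: continuous_in_subspaceT => x; rewrite inE /= in_itv /= => /itv01; exact: cf.
have fin n : (\int[mu]_(x in `[lo n, hi n]) (f x)%:E = (F (hi n) - F (lo n))%:E)%E.
  rewrite EFinB; apply: continuous_FTC2 => //.
    split.
    - move=> x; rewrite in_itv /= => /andP[h1 h2].
      by have [] := dF x (itv01 n _ (introT andP (conj (ltW h1) (ltW h2)))).
    - apply: cvg_at_right_filter.
      have h : 0 < lo n < 1 by apply: (itv01 n); rewrite lexx ltW.
      exact: der_cont (dF _ h).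
    - apply: cvg_at_left_filter.
      have h : 0 < hi n < 1 by apply: (itv01 n); rewrite lexx ltW.
      exact: der_cont (dF _ h).
  move=> x; rewrite in_itv /= => /andP[h1 h2]; rewrite derive1E.
  by have [_ ->] := dF x (itv01 n _ (introT andP (conj (ltW h1) (ltW h2)))).
have nd : nondecreasing_seq (fun n => `[lo n, hi n]%classic : set R).
  apply/nondecreasing_seqP => n; rewrite subsetEset => x /=.
  have h : lo n.+1 <= lo n by rewrite lef_pV2 ?posrE // ler_nat.
  rewrite !in_itv /= /hi -!/(lo _) => /andP[h1 h2]; apply/andP; split; first exact: le_trans h h1.
  by apply: le_trans h2 _; rewrite lerD2l lerN2.
have H : (\int[mu]_(x in `[lo i, hi i]) (f x)%:E @[i --> \oo] --> \int[mu]_(x in `]0%R, 1%R[)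
  (f x)%:E)%E.
  rewrite -exhaust.
  apply: ge0_nondecreasing_set_cvg_integral.
  - exact: nd.
  - by move=> n; exact: measurable_itv.
  - by move=> n; apply/measurable_EFinP; apply: subspace_continuous_measurable_fun.
  - by move=> n x; rewrite /= in_itv /= => /itv01 h; rewrite lee_fin f0.
have H2 : ((F (hi n) - F (lo n))%:E @[n --> \oo] --> (B - A)%:E)%E.
  apply: cvg_EFin; first exact: nearW.
  apply: cvgB.
    move/cvg_at_leftP: FB; apply; split.
      by move=> n; rewrite /hi gtrBl invr_gt0.
    by rewrite -[X in _ --> X]subr0; apply: cvgB; [exact: cvg_cst|exact: lo_cvg].
  by move/cvg_at_rightP: FA; apply; split.
have E : (fun n => \int[mu]_(x in `[lo n, hi n]) (f x)%:E)%E = (fun n => (F (hi n) - F (lo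
  n))%:E).
  by apply/funext => n; exact: fin.
rewrite E in H; exact: cvg_unique H H2.
Qed.

(** Writing f = (f + g) - g reduces to nonnegative functions: this yields
    integrability and the value of the integral at once. *)
Lemma FTC_unit_oo f F g G A B A' B' :
  (forall x : R, 0 < x < 1 -> is_derive x 1 F (f x)) ->
  (forall x : R, 0 < x < 1 -> is_derive x 1 G (g x)) ->
  (forall x : R, 0 < x < 1 -> {for x, continuous f}) ->
  (forall x : R, 0 < x < 1 -> {for x, continuous g}) ->
  (forall x : R, 0 < x < 1 -> `|f x| <= g x) ->
  F x @[x --> 0^'+] --> A -> F x @[x --> 1^'-] --> B ->
  G x @[x --> 0^'+] --> A' -> G x @[x --> 1^'-] --> B' ->
  (\int[mu]_(x in `]0%R, 1%R[) (f x)%:E = (B - A)%:E)%E.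
Proof.
move=> dF dG cf cg fg FA FB GA GB.
have g0 x : 0 < x < 1 -> 0 <= g x by move=> /fg; exact: le_trans.
have fg0 x : 0 < x < 1 -> 0 <= f x + g x.
  by move=> /fg; rewrite ler_norml => /andP[h _]; lra.
have ig := ge0_FTC_unit_oo dG cg g0 GA GB.
have ifg : (\int[mu]_(x in `]0%R, 1%R[) (f x + g x)%:E = ((B + B') - (A + A'))%:E)%E.
  apply: (@ge0_FTC_unit_oo (fun x => f x + g x) (fun x => F x + G x)) => //.
  - by move=> x h; apply: derD; [exact: dF|exact: dG].
  - by move=> x h; apply: cvgD; [exact: cf|exact: cg].
  - exact: cvgD.
  - exact: cvgD.
have integ (h : R -> R) (c : R) : (forall x : R, 0 < x < 1 -> {for x, continuous h}) ->
    (forall x : R, 0 < x < 1 -> 0 <= h x) ->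
    (\int[mu]_(x in `]0%R, 1%R[) (h x)%:E = c%:E)%E ->
    mu.-integrable `]0%R, 1%R[ (EFin \o h).
  move=> ch h0 hc; apply/integrableP; split.
    apply/measurable_EFinP; apply: open_continuous_measurable_fun => //.
    by move=> x; rewrite inE /= in_itv /=; exact: ch.
  under eq_integral => x.
    rewrite inE /= in_itv /= => /h0 hx.
    rewrite /= ger0_norm //; over.
  by rewrite hc ltry.
pose h x := f x + g x.
have -> : (\int[mu]_(x in `]0%R, 1%R[) (f x)%:E = \int[mu]_(x in `]0%R, 1%R[) ((h x)%:E - (g
  x)%:E))%E.
  by apply: eq_integral => x _; rewrite -EFinB addrK.
rewrite integralB_EFin //.
- by rewrite ifg ig -EFinB; congr EFin; ring.
- by apply: (integ _ _ _ fg0 ifg) => x x01; apply: cvgD; [exact: cf|exact: cg].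
- exact: (integ _ _ cg g0 ig).
Qed.

End UnitIntervalIntegral.

(** * The inverse hyperbolic tangent *)

Section Artanh.
Variable R : realType.
Implicit Types (x v : R).

Lemma artanh_ratio_gt0 x : -1 < x < 1 -> 0 < (1 + x) / (1 - x).
Proof. by move=> /andP[h1 h2]; rewrite divr_gt0 //; lra. Qed.

Lemma tanh_artanh x : -1 < x < 1 -> tanh (artanh x) = x.
Proof.
move=> x1; have r0 := artanh_ratio_gt0 x1; move/andP: x1 => [xN1 x1].
set v := artanh x; have e0 := expR_gt0 v.
have e2 : expR v ^+ 2 = (1 + x) / (1 - x).
  by rewrite expr2 -expRD /v /artanh -splitr lnK // posrE.
have e1 : expR v ^+ 2 * (1 - x) = 1 + x by rewrite e2 divfK // gt_eqF // subr_gt0.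
rewrite /tanh /sinh /cosh expRN; move: (expR v) e0 e1 {e2} => e e0 e1.
have d0 : 0 < e ^+ 2 + 1 by rewrite addr_gt0 ?exprn_gt0.
transitivity ((e ^+ 2 - 1) / (e ^+ 2 + 1)).
  by field; rewrite !gt_eqF.
by apply: (mulIf (lt0r_neq0 d0)); rewrite divfK ?gt_eqF //; lra.
Qed.

Lemma sech_artanh x : -1 < x < 1 -> (cosh (artanh x))^-1 = Num.sqrt (1 - x ^+ 2).
Proof.
move=> x1; have c0 := cosh_gt0 (artanh x).
rewrite -[LHS]ger0_norm ?invr_ge0 ?ltW // -sqrtr_sqr; congr Num.sqrt.
have := cosh2Bsinh2 (artanh x); have := tanh_artanh x1; rewrite /tanh.
move: (cosh _) (sinh _) c0 => c s c0 <- h.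
have -> : 1 - (s / c) ^+ 2 = (c ^+ 2 - s ^+ 2) / c ^+ 2 by field; rewrite gt_eqF.
by rewrite h mul1r exprVn.
Qed.

Lemma tanh_le_id v : 0 <= v -> tanh v <= v.
Proof.
move=> v0; rewrite /tanh ler_pdivrMr ?cosh_gt0 // -subr_ge0.
apply: (@ge0_of_derivative R (fun t => t * cosh t - sinh t) (fun t => t * sinh t) v) => //.
- by rewrite mul0r sinh0 subrr.
- move=> t; apply: der_eq (derB (derM (der_id t) (der_cosh t)) (der_sinh t)) _.
  by rewrite mul1r addrAC subrr add0r.
- by move=> t /andP[t0 _]; rewrite mulr_ge0 ?sinh_ge0.
Qed.

Lemma artanh_gt0 x : 0 < x < 1 -> 0 < artanh x.
Proof.
move=> /andP[x0 x1]; rewrite /artanh divr_gt0 // ln_gt0 // ltr_pdivlMr ?subr_gt0 //.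
by rewrite mul1r; lra.
Qed.

(** This keeps the integrands bounded at 0, where artanh vanishes. *)
Lemma artanh_ge_id x : 0 < x < 1 -> x <= artanh x.
Proof.
move=> x01; have v0 := artanh_gt0 x01; move/andP: x01 => [x0 x1].
by rewrite -{1}(@tanh_artanh x) ?tanh_le_id ?ltW // x1 (lt_trans _ x0) // ltrN10.
Qed.

Lemma der_artanh x : -1 < x < 1 -> is_derive x 1 (@artanh R) (1 - x ^+ 2)^-1.
Proof.
move=> x1; have r0 := artanh_ratio_gt0 x1; move/andP: x1 => [xN1 x1].
have d0 : 1 - x != 0 by rewrite gt_eqF // subr_gt0.
have n0 : 1 + x != 0 by rewrite gt_eqF //; lra.
have dr := derM (derD (der_cst 1 x) (der_id x)) (derV (f := fun t => 1 - t) d0 (derB (der_cst 1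
  x) (der_id x))).
have -> : @artanh R = (fun t => ln ((1 + t) * (1 - t)^-1) * 2^-1) by [].
apply: der_eq (derM (der_comp (g := fun t => (1 + t) * (1 - t)^-1) (is_derive1_ln r0) dr)
  (der_cst 2^-1 x)) _.
rewrite mulr0 addr0 add0r sub0r.
have -> : 1 - x ^+ 2 = (1 - x) * (1 + x) by ring.
by field; rewrite d0 n0.
Qed.

Lemma artanh_cvg0 : artanh x @[x --> 0^'+] --> (0 : R).
Proof.
apply: cvg_at_right_filter.
have e : artanh (0 : R) = 0 by rewrite /artanh addr0 subr0 divr1 ln1 mul0r.
have h : -1 < (0 : R) < 1 by rewrite ltrN10 ltr01.
by have := der_cont (der_artanh h); rewrite /prop_for /continuous_at e.
Qed.

Lemma artanh_cvgy : artanh x @[x --> (1 : R)^'-] --> +oo.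
Proof.
apply/cvgryPge => A; near=> x.
have x0 : 0 < x by near: x; apply: nbhs_left_gt; exact: ltr01.
have x1 : x < 1 by near: x; exact: nbhs_left_lt.
have xA : 1 - expR (- (A * 2)) < x.
  by near: x; apply: nbhs_left_gt; rewrite gtrBl expR_gt0.
have r0 : 0 < (1 + x) / (1 - x) by rewrite artanh_ratio_gt0 // x1 andbT; lra.
rewrite /artanh ler_pdivlMr // -ler_expR lnK ?posrE //.
rewrite ler_pdivlMr ?subr_gt0 //.
have : expR (A * 2) * (1 - x) <= expR (A * 2) * expR (- (A * 2)).
  by rewrite ler_wpM2l ?expR_ge0 //; lra.
by rewrite expRxMexpNx_1; lra.
Unshelve. all: by end_near. Qed.

End Artanh.

(** * The integral formulas *)

Section Assembly.
Variable R : realType.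
Notation mu := (@lebesgue_measure R).
Implicit Types (x v : R) (n m k : nat).

Lemma has_sum_zeta m : (2 <= m)%N ->
  has_sum (fun k => (k.+1%:R ^- m : R)) (zeta m%:R).
Proof.
move=> m2; have [s hs] := has_sum_inv_sqr R.
have -> : zeta m%:R = limn (series (fun k => (k.+1%:R ^- m : R))).
  rewrite /zeta; congr (limn (series _)); apply/funext => k.
  by rewrite /riemannR powR_mulrn.
apply: (has_sum_dominated hs) => k.
rewrite ger0_norm ?invr_ge0 ?exprn_ge0 // lef_pV2 ?posrE ?exprn_gt0 //.
by rewrite ler_weXn2l // ler1n.
Qed.

Lemma odd_powV_le k m : (2 <= m)%N -> (2 * k + 1)%:R ^- m <= (k.+1%:R ^+ 2)^-1 :> R.
Proof.
move=> m2; rewrite lef_pV2 ?posrE ?exprn_gt0 ?ltr0n ?addn1 //.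
apply: (@le_trans _ _ ((2 * k).+1%:R ^+ 2)).
  by rewrite lerXn2r ?nnegrE // ler_nat; lia.
by rewrite ler_weXn2l // ler1n.
Qed.

(** The even terms of the series sum to [2 ^- m] times the whole sum. *)
Lemma has_sum_odd_zeta m : (2 <= m)%N ->
  has_sum (fun k => ((2 * k + 1)%:R ^- m : R)) ((1 - 2 ^- m) * zeta m%:R).
Proof.
move=> m2; have [s hs] := has_sum_inv_sqr R.
have zs := has_sum_zeta m2.
have os := has_sum_dominated (u := fun k => ((2 * k + 1)%:R ^- m : R)) hs.
move: os; set O := limn _ => os.
have os' : has_sum (fun k => ((2 * k + 1)%:R ^- m : R)) O.
  by apply: os => k; rewrite ger0_norm ?invr_ge0 ?exprn_ge0 // odd_powV_le.
suff <- : O = (1 - 2 ^- m) * zeta m%:R by [].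
have sub : series (fun k => (k.+1%:R ^- m : R)) (K + K)%N @[K --> \oo] --> (zeta m%:R : R).
  apply: (cvg_comp (fun K => (K + K)%N) (series (fun k => (k.+1%:R ^- m : R))) _ zs).
  apply/cvgnyPge => A; near=> K.
  by apply: leq_trans (leq_addr _ _); near: K; exact: nbhs_infty_ge.
have e : (fun K => series (fun k => (k.+1%:R ^- m : R)) (K + K)%N) =
  (fun K => series (fun k => ((2 * k + 1)%:R ^- m : R)) K + 2 ^- m * series (fun k => (k.+1%:R
    ^- m : R)) K).
  apply/funext; elim=> [|K IH]; first by rewrite addn0 /series /= !big_nil mulr0 addr0.
  have e1 : (K + K).+1%:R ^- m = (2 * K + 1)%:R ^- m :> R by rewrite addn1 mul2n addnn.
  have e2 : (K + K).+2%:R ^- m = 2 ^- m * K.+1%:R ^- m :> R.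
    by rewrite -invfM -exprMn -natrM mulnS mul2n addnn.
  by rewrite addSn addnS !seriesSr IH e1 e2; ring.
have lim2 : O + 2 ^- m * zeta m%:R = zeta m%:R.
  apply: cvg_unique sub => //; rewrite e.
  by apply: cvgD => //; exact: cvgMl_tmp.
by rewrite mulrBl mul1r; apply/eqP; rewrite eq_sym subr_eq lim2.
Unshelve. all: by end_near. Qed.

Lemma has_sum_beta m : (2 <= m)%N ->
  has_sum (fun k => (-1) ^+ k * ((2 * k + 1)%:R ^- m : R)) (dirichlet_beta m%:R).
Proof.
move=> m2; have [s hs] := has_sum_inv_sqr R.
have -> : dirichlet_beta m%:R = limn (series (fun k => (-1) ^+ k * ((2 * k + 1)%:R ^- m : R))).
  rewrite /dirichlet_beta; congr (limn (series _)); apply/funext => k.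
  by rewrite powRN powR_mulrn.
apply: (has_sum_dominated hs) => k.
rewrite normrM normrX normrN1 expr1n mul1r ger0_norm ?invr_ge0 ?exprn_ge0 //.
exact: odd_powV_le.
Qed.

Lemma node_powV k m : node R k ^- m = (2 / pi) ^+ m * (2 * k + 1)%:R ^- m.
Proof.
have -> : 2 / pi = (pi / 2)^-1 :> R by rewrite invf_div.
by rewrite /node exprMn invfM mulrC exprVn.
Qed.

Lemma horner_bounded (p : {poly R}) : exists C, forall x, 0 < x < 1 -> `|p.[x]| <= C.
Proof.
exists (\sum_(i < size p) `|p`_i|) => x /andP[x0 x1]; rewrite horner_coef.
apply: le_trans (ler_norm_sum _ _ _) _; apply: ler_sum => i _.
by rewrite normrM ler_piMr // ger0_norm ?exprn_ge0 ?exprn_ile1 // ltW.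
Qed.

Lemma eval_rat_even_poly (c : rat) (a : nat -> int) n x :
  eval_rat (c *: \sum_(0 <= t < n) (a t)%:~R *: 'X^(2 * t)) x =
  ratr c * \sum_(0 <= t < n) (a t)%:~R * x ^+ (2 * t).
Proof.
rewrite /eval_rat map_polyZ hornerZ rmorph_sum horner_sum; congr (_ * _).
apply: eq_bigr => t _.
by rewrite /= map_polyZ hornerZ /= map_polyXn hornerXn ratr_int.
Qed.

(** In the variable x the antiderivative is kappa times that of
    [pole_series_antiderivative] at artanh x; its limits at 0 and 1 are those of
    the latter at 0 and at infinity.  The dominating function [g] gives
    integrability. *)
Lemma integral_pole_series (alpha : nat -> R) (A L kappa : R) m (f phi g G : R -> R) (A' B' : R) :
  (2 <= m)%N -> (forall k, `|alpha k| <= A) ->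
  has_sum (fun k => alpha k * node R k ^- m) L ->
  (forall v, 0 < v -> has_sum (fun k => alpha k * pole_im m (node R k) v) (f v)) ->
  (forall x : R, 0 < x < 1 -> phi x = kappa * (f (artanh x) / artanh x) / (1 - x ^+ 2)) ->
  (forall x : R, 0 < x < 1 -> {for x, continuous phi}) ->
  (forall x : R, 0 < x < 1 -> is_derive x 1 G (g x)) ->
  (forall x : R, 0 < x < 1 -> {for x, continuous g}) ->
  (forall x : R, 0 < x < 1 -> `|phi x| <= g x) ->
  G x @[x --> (0 : R)^'+] --> A' -> G x @[x --> (1 : R)^'-] --> B' ->
  (\int[mu]_(x in `]0%R, 1%R[) (phi x)%:E = (kappa * (L * (pi / 2)))%:E)%E.
Proof.
move=> m2 aA aL fs phiE cphi dG cg phig G0 G1.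
have [Psi [dPsi P0 P1]] := pole_series_antiderivative m2 aA aL.
have -> : kappa * (L * (pi / 2)) = kappa * (L * (pi / 2)) - kappa * 0 by rewrite mulr0 subr0.
apply: (@FTC_unit_oo R phi (fun x => kappa * Psi (artanh x)) g G _ _ A' B') => //.
- move=> x x01; have v0 := artanh_gt0 x01.
  have x1 : -1 < x < 1 by move/andP: x01 => [x0 ->]; rewrite (lt_trans _ x0) // ltrN10.
  apply: der_eq (der_scale kappa (der_comp (dPsi _ _ v0 (fs _ v0)) (der_artanh x1))) _.
  by rewrite phiE // mulrA.
- by apply: cvgMl_tmp; exact: cvg_comp (@artanh_cvg0 R) P0.
- by apply: cvgMl_tmp; exact: cvg_comp (@artanh_cvgy R) P1.
Qed.

(** The integrand is bounded, because x <= artanh x.  The constant [kappa] is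
    what remains of the normalization of Lambda after taking out the partial
    fraction coefficients 2 (-1)^n (2n)! of the 2n-th derivative of tanh and the
    factor -2 of [tanh_poly_calC]. *)
Lemma zeta_integral n : (1 <= n)%N ->
  ((zeta (2 * n + 1)%:R / pi ^+ (2 * n))%:E =
    \int[mu]_(x in `]0%R, 1%R[) (x * eval_rat (Lambda n) x / artanh x)%:E)%E.
Proof.
move=> n1; have m2 : (2 <= 2 * n + 1)%N by lia.
have pi0 := @pi_gt0 R.
pose kappa : R := 2 / (2 ^+ (2 * n + 1) - 1).
have p2 : 2 ^+ (2 * n + 1) - 1 != 0 :> R.
  by rewrite subr_eq0 gt_eqF // exprn_egt1 // ?ltr1n //; lia.
have f0 : (2 * n)`!%:R != 0 :> R by rewrite pnatr_eq0 -lt0n fact_gt0.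
pose f v : R := (2 * ((-1) ^+ n * (2 * n)`!%:R))^-1 * (tanh_poly R (2 * n)).[tanh v].
have fs v : 0 < v -> has_sum (fun k => 1 * pole_im (2 * n + 1) (node R k) v) (f v).
  move=> v0.
  have h0 t : 0 < t -> has_sum (fun k => 2 * pole_im 1 (node R k) t) (tanh_poly R 0).[tanh t].
    by move=> t0; rewrite hornerX; exact: tanh_partial_fractions.
  have := @pole_im_series_iter R (fun=> 2) 2 0 (fun i t => (tanh_poly R i).[tanh t]) _ _ h0 n v
    v0.
  move=> H; apply: has_sum_ext (has_sumZ (2 * ((-1) ^+ n * (2 * n)`!%:R))^-1 (H _ _)) _.
  - by move=> k; rewrite ger0_norm.
  - by move=> i t _; exact: der_tanh_poly.
  move=> k; rewrite add0n addn1 fact0 divr1 mul1r.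
  by field; rewrite f0 signr_eq0.
have [C hC] := horner_bounded (map_poly ratr (Lambda n)).
have C0 : 0 <= C by apply: le_trans (hC 2^-1 _) => //; rewrite invr_gt0 ltr0n invf_lt1 // ltr1n.
have aL := has_sumZ ((2 / pi) ^+ (2 * n + 1)) (has_sum_odd_zeta m2).
have aL' : has_sum (fun k => 1 * node R k ^- (2 * n + 1))
   ((2 / pi) ^+ (2 * n + 1) * ((1 - 2 ^- (2 * n + 1)) * zeta (2 * n + 1)%:R)).
  by apply: has_sum_ext aL _ => k; rewrite mul1r node_powV.
have dG (x : R) : 0 < x < 1 -> is_derive x 1 (fun t => C * t) C.
  by move=> _; apply: der_eq (der_scale C (der_id x)) _; exact: mulr1.
apply: etrans (esym (@integral_pole_series (fun=> 1) 1 _ kappa (2 * n + 1) f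
  (fun x => x * eval_rat (Lambda n) x / artanh x) (fun=> C) (fun t => C * t) 0 C m2 _ aL' fs _
    _ dG _ _ _ _)) => //.
- congr EFin; rewrite /kappa expr_div_n [pi ^+ (2 * n + 1)]exprD expr1.
  have q0 : 2 ^+ (2 * n + 1) != 0 :> R by rewrite expf_neq0.
  have r0 : pi ^+ (2 * n) != 0 :> R by rewrite expf_neq0 // gt_eqF.
  have pn : pi != 0 :> R by rewrite gt_eqF.
  move: (zeta _) (pi : R) pn r0 => Z P pn r0.
  by field; rewrite p2 q0 r0 pn.
- by move=> k; rewrite normr1.
- move=> x x01; have v0 := artanh_gt0 x01; move/andP: (x01) => [x0 x1].
  have xN1 : -1 < x by rewrite (lt_trans _ x0) // ltrN10.
  rewrite /f tanh_artanh ?xN1 // tanh_poly_calC // /Lambda eval_rat_even_poly.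
  rewrite fmorph_div /= !rmorphM rmorphXn rmorphN1 rmorphB rmorphXn rmorph1 !rmorph_nat.
  move: (\sum_(0 <= t < n) _) => S; rewrite /kappa exprS.
  have d0 : 1 - x ^+ 2 != 0.
    by rewrite subr_eq0 gt_eqF // exprn_ilt1 // ltW.
  have s2 : (-1) ^+ n * (-1) ^+ n = 1 :> R by rewrite -expr2 sqrr_sign.
  have sn : ((-1) ^+ n)^-1 = (-1) ^+ n :> R by rewrite -signr_odd; case: odd;
    rewrite ?expr0 ?expr1 ?invrN invr1.
  move: (artanh x) v0 => v v0; have vn : v != 0 by rewrite gt_eqF.
  rewrite !invfM sn.
  by field; rewrite d0 p2 f0 vn.
- move=> x x01; have v0 := artanh_gt0 x01; move/andP: (x01) => [x0 x1].
  have xN1 : -1 < x by rewrite (lt_trans _ x0) // ltrN10.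
  apply: cvgM; first by apply: cvgM; [exact: cvg_id|exact: continuous_horner].
  apply: cvgV; first by rewrite gt_eqF.
  have xN : -1 < x < 1 by rewrite xN1.
  exact: der_cont (der_artanh xN).
- by move=> x _; exact: cvg_cst.
- move=> x x01; have v0 := artanh_gt0 x01; have vx := artanh_ge_id x01;
  move/andP: (x01) => [x0 x1].
  rewrite normrM normrM normfV (gtr0_norm x0) (gtr0_norm v0) ler_pdivrMr // mulrC.
  by apply: ler_pM => //; [exact: ltW|exact: hC].
- by rewrite -[X in _ --> X](mulr0 C); apply: cvgMl_tmp; apply: cvg_at_right_filter;
  exact: cvg_id.
- by rewrite -[X in _ --> X](mulr1 C); apply: cvgMl_tmp; apply: cvg_at_left_filter; exact: cvg_id.
Qed.

(** The integrand is O(1 / sqrt (1 - x)), because x <= artanh x and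
    1 - x <= 1 - x^2.  The derivative of order 2n - 1 of sech is reached from its
    first derivative in n - 1 steps of two derivatives each. *)
Lemma beta_integral n : (1 <= n)%N ->
  ((dirichlet_beta (2 * n)%:R / pi ^+ (2 * n - 1))%:E =
    \int[mu]_(x in `]0%R, 1%R[)
      (x * eval_rat (Xi n) x / (Num.sqrt (1 - x ^+ 2) * artanh x))%:E)%E.
Proof.
move=> n1; have m2 : (2 <= 2 * n)%N by lia.
have pi0 := @pi_gt0 R.
have e1 : (2 * n - 1 = 1 + 2 * (n - 1))%N by lia.
have e2 : (2 * n = (1 + 2 * (n - 1)).+1)%N by lia.
have e3 : (2 * n - 1 = (2 * (n - 1)).+1)%N by lia.
have e4 : n = (n - 1).+1 by lia.
pose kappa : R := 2 ^- (2 * n - 1).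
have f0 : (2 * n - 1)`!%:R != 0 :> R by rewrite pnatr_eq0 -lt0n fact_gt0.
pose f v : R := (2 * ((-1) ^+ n * (2 * n - 1)`!%:R))^-1 *
  ((cosh v)^-1 * (sech_poly R (2 * n - 1)).[tanh v]).
have fs v : 0 < v -> has_sum (fun k => (-1) ^+ k * pole_im (2 * n) (node R k) v) (f v).
  move=> v0.
  (* The sign is that of the derivative - sinh / cosh^2 of sech. *)
  have h0 t : 0 < t -> has_sum (fun k => -2 * (-1) ^+ k * pole_im 2 (node R k) t)
      ((cosh t)^-1 * (sech_poly R 1).[tanh t]).
    move=> t0; have -> : (cosh t)^-1 * (sech_poly R 1).[tanh t] = -1 * (sinh t / cosh t ^+ 2).
      rewrite /= -polyC1 derivC mulr0 sub0r mulr1 hornerN hornerX /tanh.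
      by field; rewrite gt_eqF // cosh_gt0.
    by apply: has_sum_ext (has_sumZ (-1) (sech_der_partial_fractions t0)) _ => k; ring.
  have aA k : `|-2 * (-1) ^+ k| <= 2 :> R.
    by rewrite normrM normrX normrN1 expr1n mulr1 normrN ger0_norm.
  have := @pole_im_series_iter R _ 2 1 (fun i t => (cosh t)^-1 * (sech_poly R i.+1).[tanh t])
    aA (fun i t _ => der_sech_poly i.+1 t) h0 (n - 1)%N v v0.
  rewrite -e1 -e3 => H.
  apply: has_sum_ext (has_sumZ (2 * ((-1) ^+ n * (2 * n - 1)`!%:R))^-1 H) _ => k.
  have -> : (2 * n - 1).+1 = (2 * n)%N by lia.
  have -> : (-1) ^+ n = - (-1) ^+ (n - 1) :> R by rewrite {1}e4 exprS mulN1r.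
  rewrite divr1; field.
  by rewrite f0 signr_eq0.
have [C hC] := horner_bounded (map_poly ratr (Xi n)).
have C0 : 0 <= C by apply: le_trans (hC 2^-1 _) => //; rewrite invr_gt0 ltr0n invf_lt1 // ltr1n.
have aL : has_sum (fun k => (-1) ^+ k * node R k ^- (2 * n))
   ((2 / pi) ^+ (2 * n) * dirichlet_beta (2 * n)%:R).
  apply: has_sum_ext (has_sumZ ((2 / pi) ^+ (2 * n)) (has_sum_beta m2)) _ => k.
  by rewrite node_powV; ring.
have csqrt (y : R) : Num.sqrt (1 - x) @[x --> y] --> Num.sqrt (1 - y).
  apply: (@continuous_comp _ _ _ (fun x => 1 - x) Num.sqrt).
    by apply: cvgB; [exact: cvg_cst|exact: cvg_id].
  exact: sqrt_continuous.
have dG (x : R) : 0 < x < 1 ->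
    is_derive x 1 (fun t => C * (-2 * Num.sqrt (1 - t))) (C * (Num.sqrt (1 - x))^-1).
  move=> /andP[x0 x1]; have y0 : 0 < 1 - x by rewrite subr_gt0.
  have s0 : Num.sqrt (1 - x) != 0 by rewrite gt_eqF // sqrtr_gt0.
  apply: der_eq (der_scale C (der_scale (-2) (der_comp (g := fun t => 1 - t) (is_derive1_sqrt y0)
    (derB (der_cst 1 x) (der_id x))))) _.
  by rewrite sub0r; field.
have aA k : `|(-1) ^+ k| <= 1 :> R by rewrite normrX normrN1 expr1n.
apply: etrans (esym (@integral_pole_series (fun k => (-1) ^+ k) 1 _ kappa (2 * n) f
  (fun x => x * eval_rat (Xi n) x / (Num.sqrt (1 - x ^+ 2) * artanh x))
  (fun x => C * (Num.sqrt (1 - x))^-1) (fun t => C * (-2 * Num.sqrt (1 - t)))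
  (C * (-2 * Num.sqrt (1 - 0))) (C * (-2 * Num.sqrt (1 - 1))) m2 aA aL fs _ _ dG _ _ _ _)) => //.
- congr EFin; rewrite /kappa expr_div_n.
  have -> : 2 ^+ (2 * n) = 2 * 2 ^+ (2 * n - 1) :> R by rewrite -exprS; congr (_ ^+ _); lia.
  have -> : pi ^+ (2 * n) = pi * pi ^+ (2 * n - 1) :> R by rewrite -exprS; congr (_ ^+ _); lia.
  have q0 : 2 ^+ (2 * n - 1) != 0 :> R by rewrite expf_neq0.
  have r0 : pi ^+ (2 * n - 1) != 0 :> R by rewrite expf_neq0 // gt_eqF.
  have pn : pi != 0 :> R by rewrite gt_eqF.
  move: (dirichlet_beta _) (pi : R) pn r0 => Z P pn r0.
  by field; rewrite q0 r0 pn.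
- move=> x x01; have v0 := artanh_gt0 x01; move/andP: (x01) => [x0 x1].
  have xN1 : -1 < x < 1 by rewrite (lt_trans _ x0) // ltrN10.
  have d0 : 0 < 1 - x ^+ 2 by rewrite subr_gt0 exprn_ilt1 // ltW.
  rewrite /f tanh_artanh // sech_artanh // sech_poly_calC // /Xi eval_rat_even_poly.
  rewrite fmorph_div /= !rmorphM !rmorphXn rmorphN1 !rmorph_nat.
  move: (\sum_(0 <= t < n) _) => S; rewrite /kappa [(-1) ^+ n.+1]exprS.
  have ss := sqr_sqrtr (ltW d0).
  have s0 : Num.sqrt (1 - x ^+ 2) != 0 by rewrite gt_eqF // sqrtr_gt0.
  have sn : ((-1) ^+ n)^-1 = (-1) ^+ n :> R by rewrite -signr_odd; case: odd;
    rewrite ?expr0 ?expr1 ?invrN invr1.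
  have -> : (4 * n - 2 = (2 * n - 1) + (2 * n - 1))%N by lia.
  have q0 : 2 ^+ (2 * n - 1) != 0 :> R by rewrite expf_neq0.
  rewrite -{3}ss; move: (artanh x) v0 => v v0; have vn : v != 0 by rewrite gt_eqF.
  move: (Num.sqrt _) s0 {ss} => s s0.
  rewrite exprD !invfM sn; field.
  by rewrite s0 vn f0 q0.
- move=> x x01; have v0 := artanh_gt0 x01; move/andP: (x01) => [x0 x1].
  have xN1 : -1 < x < 1 by rewrite (lt_trans _ x0) // ltrN10.
  have d0 : 0 < 1 - x ^+ 2 by rewrite subr_gt0 exprn_ilt1 // ltW.
  apply: cvgM; first by apply: cvgM; [exact: cvg_id|exact: continuous_horner].
  apply: cvgV; first by rewrite mulf_neq0 // gt_eqF // sqrtr_gt0.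
  apply: cvgM; last exact: der_cont (der_artanh xN1).
  apply: (@continuous_comp _ _ _ (fun x => 1 - x ^+ 2) Num.sqrt); last exact: sqrt_continuous.
  by apply: cvgB; [exact: cvg_cst|exact: exprn_continuous].
- move=> x /andP[x0 x1]; apply: cvgMl_tmp; apply: cvgV; last exact: csqrt.
  by rewrite gt_eqF // sqrtr_gt0 subr_gt0.
- move=> x x01; have v0 := artanh_gt0 x01; have vx := artanh_ge_id x01;
  move/andP: (x01) => [x0 x1].
  have y0 : 0 < 1 - x by rewrite subr_gt0.
  have d0 : 0 < 1 - x ^+ 2 by rewrite subr_gt0 exprn_ilt1 // ltW.
  have s1 : 0 < Num.sqrt (1 - x) by rewrite sqrtr_gt0.
  have s2 : Num.sqrt (1 - x) <= Num.sqrt (1 - x ^+ 2).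
    by rewrite ler_sqrt ?ltW //; nra.
  have s3 : 0 < Num.sqrt (1 - x ^+ 2) by rewrite sqrtr_gt0.
  rewrite normrM normrM normfV (gtr0_norm x0) (gtr0_norm (mulr_gt0 s3 v0)) invfM.
  have -> : x * `|eval_rat (Xi n) x| * ((Num.sqrt (1 - x ^+ 2))^-1 * (artanh x)^-1) =
     (x / artanh x * `|eval_rat (Xi n) x|) * (Num.sqrt (1 - x ^+ 2))^-1 by ring.
  apply: ler_pM.
  + by rewrite mulr_ge0 // divr_ge0 // ltW.
  + by rewrite invr_ge0 ltW.
  + rewrite -[C]mul1r; apply: ler_pM => //; first by rewrite divr_ge0 // ltW.
      by rewrite ler_pdivrMr // mul1r.
    exact: hC.
  + by rewrite lef_pV2 ?posrE.
- by apply: cvgMl_tmp; apply: cvgMl_tmp; apply: cvg_at_right_filter; exact: csqrt.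
- by apply: cvgMl_tmp; apply: cvgMl_tmp; apply: cvg_at_left_filter; exact: csqrt.
Qed.

End Assembly.

Theorem theorem3p1 (R : realType) (n : nat) (hn : (1 <= n)%N) :
  (dirichlet_beta (2 * n)%:R / pi ^+ (2 * n - 1))%:E =
    (\int[@lebesgue_measure R]_(x in `]0%R, 1%R[)
      (x * eval_rat (Xi n) x / (Num.sqrt (1 - x ^+ 2) * artanh x))%:E)%E
  /\
  (zeta (2 * n + 1)%:R / pi ^+ (2 * n))%:E =
    (\int[@lebesgue_measure R]_(x in `]0%R, 1%R[)
      (x * eval_rat (Lambda n) x / artanh x)%:E)%E.
Proof. by split; [exact: beta_integral|exact: zeta_integral]. Qed.
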